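(* For all functions $\varphi\in C^2(\mathbb{R}^n)\cap L^2(\mathbb{R}^n,\gamma_n)$ with $\|\nabla^2\varphi\|_{HS}\in L^2(\mathbb{R}^n,\gamma_n)$ we have $$\int_{\mathbb{R}^n}\left[\|\nabla\varphi\|^2-\frac{\|\nabla^2\varphi\|_{HS}^2}{2}\right]d\gamma_n\;\le\;\operatorname{Var}_{\gamma_n}(\varphi).$$ There is equality for all polynomials $\varphi$ of degree $2$.
   Context: $\gamma_n$ is the standard Gaussian probability measure on $\mathbb{R}^n$, $d\gamma_n=(2\pi)^{-n/2}e^{-\|x\|^2/2}dx$; $\|\cdot\|$ is the Euclidean norm; $\nabla^2\varphi$ is the Hessian matrix of $\varphi$ and $\|\cdot\|_{HS}$ is the Hilbert–Schmidt norm of matrices; $\operatorname{Var}_{\gamma_n}(\varphi)=\int_{\mathbb{R}^n}\varphi^2d\gamma_n-\left(\int_{\mathbb{R}^n}\varphi\,d\gamma_n\right)^2$. *)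

(* Defs.v *)
From HB Require Import structures.
From mathcomp Require Import all_boot all_order all_algebra.
From mathcomp Require Import all_classical all_reals all_analysis.
From mathcomp Require Import measurable_realfun.
(* Not imported: its notations clash with those of MathComp-Analysis. *)
From mathcomp.multinomials Require mpoly.

Set Implicit Arguments.
Unset Strict Implicit.
Unset Printing Implicit Defensive.
Import Order.TTheory GRing.Theory Num.Theory.
Import numFieldNormedType.Exports.

Local Open Scope classical_set_scope.
Local Open Scope ring_scope.

(* The Borel sigma-algebra of R^n, generated by the coordinate functions just
   as the library does for n.-tuple T. *)
Section measurable_rV.
Context {R : realType} (n : nat).

Definition rV_coor (i : 'I_n) (x : 'rV[R]_n) : R := x ord0 i.

Let rV_set0 : g_sigma_preimage rV_coor set0.
Proof. exact: sigma_algebra0. Qed.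

Let rV_setC A : g_sigma_preimage rV_coor A -> g_sigma_preimage rV_coor (~` A).
Proof. exact: sigma_algebraC. Qed.

Let rV_bigcup (F : (set 'rV[R]_n)^nat) :
  (forall i, g_sigma_preimage rV_coor (F i)) ->
  g_sigma_preimage rV_coor (\bigcup_i (F i)).
Proof. exact: sigma_algebra_bigcup. Qed.

HB.instance Definition _ := @isMeasurable.Build default_measure_display
  'rV[R]_n (g_sigma_preimage rV_coor) rV_set0 rV_setC rV_bigcup.

Lemma measurable_rV_coor i : measurable_fun [set: 'rV[R]_n] (rV_coor i).
Proof.
move=> _ Y mY; rewrite setTI; apply: sub_sigma_algebra => /=.
rewrite -bigcup_seq/=; exists i => /=; first by rewrite mem_index_enum.
by exists Y => //; rewrite setTI.
Qed.

Lemma measurable_fun_rVP d (T : measurableType d) (f : T -> 'rV[R]_n) :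
  (forall i, measurable_fun [set: T] (rV_coor i \o f)) ->
  measurable_fun [set: T] f.
Proof.
move=> mf.
suff H : g_sigma_preimage (fun i => rV_coor i \o f) `<=` measurable.
  by move=> _ A mA; apply: H; rewrite g_sigma_preimage_comp; exists A.
apply: smallest_sub; first exact: sigma_algebra_measurable.
rewrite -bigcup_seq/=; apply: bigcup_sub => i _.
by move=> A [B mB <-]; exact: mf.
Qed.

End measurable_rV.

Section lebesgue_rV.
Context {R : realType}.
Local Open Scope ereal_scope.

(* (a, (y_1, ..., y_n)) |-> (a, y_1, ..., y_n), with inverse rV_uncons. *)
Definition rV_cons n (p : R * 'rV[R]_n) : 'rV[R]_n.+1 :=
  \row_i oapp (fun j => p.2 ord0 j) p.1 (unlift ord0 i).

Definition rV_uncons n (x : 'rV[R]_n.+1) : R * 'rV[R]_n :=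
  (x ord0 ord0, \row_j x ord0 (lift ord0 j)).

Lemma rV_consK n : cancel (@rV_cons n) (@rV_uncons n).
Proof.
move=> [a y]; rewrite /rV_uncons /rV_cons !mxE unlift_none/=; congr (_, _).
by apply/rowP => j; rewrite !mxE liftK.
Qed.

Lemma measurable_rV_cons n :
  measurable_fun [set: R * 'rV[R]_n] (@rV_cons n).
Proof.
apply: measurable_fun_rVP => i; rewrite /rV_cons /rV_coor /comp.
under eq_fun do rewrite mxE.
case: (unlift ord0 i) => [j|]/=; last exact: measurable_fst.
exact: (measurableT_comp (measurable_rV_coor j) measurable_snd).
Qed.

Lemma measurable_rV_uncons n :
  measurable_fun [set: 'rV[R]_n.+1] (@rV_uncons n).
Proof.
apply/measurable_fun_pairP; split; first exact: measurable_rV_coor.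
apply: measurable_fun_rVP => i; rewrite /rV_uncons /rV_coor /comp/=.
under eq_fun do rewrite mxE.
exact: measurable_rV_coor.
Qed.

Section cons.
Variables (n : nat) (mu : {sigma_finite_measure set 'rV[R]_n -> \bar R}).

Definition lebesgue_rV_cons : set 'rV[R]_n.+1 -> \bar R :=
  pushforward (lebesgue_measure \x mu) (@rV_cons n).

Let prod := (@lebesgue_measure R \x mu).

Let cons0 : lebesgue_rV_cons set0 = 0.
Proof. by rewrite /lebesgue_rV_cons /pushforward preimage_set0 measure0. Qed.

Let cons_ge0 A : 0 <= lebesgue_rV_cons A.
Proof. exact: (measure_ge0 prod). Qed.

Let mcons A : measurable A -> measurable (@rV_cons n @^-1` A).
Proof.
by move=> mA; rewrite -[X in measurable X]setTI; exact: measurable_rV_cons.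
Qed.

Let cons_sigma_additive : semi_sigma_additive lebesgue_rV_cons.
Proof.
move=> F mF tF mUF; rewrite /lebesgue_rV_cons /pushforward preimage_bigcup.
apply: (@measure_semi_sigma_additive _ _ _ prod).
- by move=> k; exact: mcons.
- apply/trivIsetP => /= i j _ _ ij; rewrite -preimage_setI.
  by move/trivIsetP : tF => /(_ _ _ _ _ ij) ->//; rewrite preimage_set0.
- by rewrite -preimage_bigcup; exact: mcons.
Qed.

HB.instance Definition _ := isMeasure.Build _ _ _
  lebesgue_rV_cons cons0 cons_ge0 cons_sigma_additive.

Let cons_sigma_finite : sigma_finite setT lebesgue_rV_cons.
Proof.
have /sigma_finiteP[F [TF ndF Foo]] := sigma_finiteT (@lebesgue_measure R).
have /sigma_finiteP[G [TG ndG Goo]] := sigma_finiteT mu.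
exists (fun k => @rV_uncons n @^-1` (F k `*` G k)).
  rewrite -preimage_bigcup; apply/seteqP; split=> // x _ /=.
  have [k _ Fk] : (\bigcup_k F k) (rV_uncons x).1 by rewrite -TF.
  have [l _ Gl] : (\bigcup_k G k) (rV_uncons x).2 by rewrite -TG.
  exists (maxn k l) => //; split.
  - by move: Fk; exact/subsetPset/ndF/leq_maxl.
  - by move: Gl; exact/subsetPset/ndG/leq_maxr.
move=> k; have [mF Fk] := Foo k; have [mG Gk] := Goo k; split.
  rewrite -[X in measurable X]setTI; apply: measurable_rV_uncons => //.
  exact: measurableX.
rewrite /lebesgue_rV_cons /pushforward -comp_preimage.
rewrite (_ : _ \o _ = id) ?preimage_id.
  by rewrite product_measure1E// lte_mul_pinfty// ge0_fin_numE.
by apply/funext => p; exact: rV_consK.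
Qed.

HB.instance Definition _ := Measure_isSigmaFinite.Build _ _ _
  lebesgue_rV_cons cons_sigma_finite.
End cons.

(* Lebesgue measure on R^n, as the n-fold product of the one on R. *)
Fixpoint lebesgue_rV n : {sigma_finite_measure set 'rV[R]_n -> \bar R} :=
  match n with
  | 0%N => \d_(0%R : 'rV[R]_0)
  | n'.+1 => lebesgue_rV_cons (lebesgue_rV n')
  end.

End lebesgue_rV.

Section gauss.
Context {R : realType} (n : nat).
Implicit Types (x : 'rV[R]_n) (f : 'rV[R]_n -> R).

(* `|x| is the sup norm on 'rV[R]_n. *)
Definition norm2 x : R := Num.sqrt (\sum_(i < n) x ord0 i ^+ 2).

Definition normHS (A : 'M[R]_n) : R :=
  Num.sqrt (\sum_(i < n) \sum_(j < n) A i j ^+ 2).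

Definition gauss_density x : R :=
  (2 * pi) `^ (- (n%:R / 2)) * expR (- (norm2 x ^+ 2 / 2)).

Lemma gauss_density_ge0 x : 0 <= gauss_density x.
Proof. by rewrite mulr_ge0 ?powR_ge0 ?expR_ge0. Qed.

Lemma sqr_norm2 x : norm2 x ^+ 2 = \sum_(i < n) x ord0 i ^+ 2.
Proof. by rewrite sqr_sqrtr// sumr_ge0// => i _; exact: sqr_ge0. Qed.

Lemma measurable_gauss_density : measurable_fun [set: 'rV[R]_n] gauss_density.
Proof.
apply: measurable_funM => //=; apply: measurableT_comp => //=.
apply: measurableT_comp => //=; apply: measurable_funM => //=.
under eq_fun do rewrite sqr_norm2.
apply: measurable_sum => i; apply: measurable_funX.
exact: measurable_rV_coor.
Qed.

Definition gauss (A : set 'rV[R]_n) : \bar R :=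
  (\int[lebesgue_rV n]_(x in A) (gauss_density x)%:E)%E.

Let gauss0 : gauss set0 = 0%E.
Proof. by rewrite /gauss integral_set0. Qed.

Let gauss_ge0 A : (0 <= gauss A)%E.
Proof.
by apply: integral_ge0 => x _; rewrite lee_fin gauss_density_ge0.
Qed.

Let gauss_sigma_additive : semi_sigma_additive gauss.
Proof.
move=> /= A mA tA mUA; rewrite /gauss ge0_integral_bigcup//=.
- apply: is_cvg_ereal_nneg_natsum_cond => k _ _.
  by apply: integral_ge0 => x _; rewrite lee_fin gauss_density_ge0.
- apply/measurable_EFinP; apply: measurable_funTS.
  exact: measurable_gauss_density.
- by move=> x _; rewrite lee_fin gauss_density_ge0.
Qed.

HB.instance Definition _ := isMeasure.Build _ _ _
  gauss gauss0 gauss_ge0 gauss_sigma_additive.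

End gauss.
Arguments gauss {R} n.

Section gauss_probability.
Context {R : realType}.
Local Open Scope ereal_scope.

Lemma sqr_norm2_cons n (p : R * 'rV[R]_n) :
  (norm2 (rV_cons p) ^+ 2 = p.1 ^+ 2 + norm2 p.2 ^+ 2)%R.
Proof.
rewrite !sqr_norm2 big_ord_recl /rV_cons !mxE unlift_none/=; congr (_ + _)%R.
by apply: eq_bigr => i _; rewrite mxE liftK.
Qed.

Lemma gauss_density_cons n (p : R * 'rV[R]_n) :
  gauss_density (rV_cons p) = (normal_pdf 0 1 p.1 * gauss_density p.2)%R.
Proof.
have pi20 : (0 < 2 * pi :> R)%R by rewrite mulr_gt0// pi_gt0.
rewrite normal_pdfE ?oner_neq0// /normal_peak /normal_fun /gauss_density.
rewrite sqr_norm2_cons mulrACA -expRD subr0 expr1n mul1r mulNr.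
rewrite -opprD -mulrDl; congr (_ * expR _)%R.
rewrite -(natr1 n) [((_ + 1) / 2)%R]mulrDl opprD addrC powRD; last first.
  by apply/implyP => _; exact: lt0r_neq0.
by rewrite mul1r powRN powR12_sqrt ?ltW// mulr_natl.
Qed.

Lemma gauss_setT n : gauss n [set: 'rV[R]_n] = 1.
Proof.
elim: n => [|n IH]; rewrite /gauss.
  rewrite integral_dirac//=; last first.
    by apply/measurable_EFinP; exact: measurable_gauss_density.
  rewrite diracT mul1e /gauss_density sqr_norm2 big_ord0 !mul0r oppr0 powRr0.
  by rewrite expR0 mulr1.
rewrite ge0_integral_pushforward//=; first last.
- by move=> x _; rewrite lee_fin gauss_density_ge0.
- by apply/measurable_EFinP; exact: measurable_gauss_density.
- exact: measurable_rV_cons.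
rewrite preimage_setT.
under eq_integral do rewrite gauss_density_cons EFinM.
rewrite fubini_tonelli1//=; first last.
- by move=> x; rewrite mule_ge0// lee_fin ?normal_pdf_ge0 ?gauss_density_ge0.
- apply: emeasurable_funM; apply/measurable_EFinP.
    by apply: measurableT_comp => //; exact: measurable_normal_pdf.
  by apply: measurableT_comp => //; exact: measurable_gauss_density.
rewrite -(@integral_normal_pdf R 0 1); apply: eq_integral => x _.
rewrite /fubini_F/= ge0_integralZl//=; first last.
- by rewrite lee_fin normal_pdf_ge0.
- by move=> y _; rewrite lee_fin gauss_density_ge0.
- by apply/measurable_EFinP; exact: measurable_gauss_density.
by rewrite [X in _ * X]IH mule1.
Qed.

HB.instance Definition _ n :=
  Measure_isProbability.Build _ _ _ (@gauss R n) (gauss_setT n).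

End gauss_probability.

Section calculus.
Context {R : realType} (n : nat).
Implicit Types (x : 'rV[R]_n) (f : 'rV[R]_n -> R).

(* Both integrals are finite when f is square integrable. *)
Definition gauss_var f : \bar R :=
  (\int[gauss n]_x (f x ^+ 2)%:E - (\int[gauss n]_x (f x)%:E) ^+ 2)%E.

Definition partial (i : 'I_n) f : 'rV[R]_n -> R := 'D_(delta_mx ord0 i) f.

Definition grad f x : 'rV[R]_n := \row_i partial i f x.

Definition hess f x : 'M[R]_n := \matrix_(i, j) partial i (partial j f) x.

(* f is of class C^k: all its partial derivatives of order at most k exist
   everywhere and are continuous. *)
Fixpoint Ck k f : Prop :=
  match k with
  | 0%N => continuous f
  | k'.+1 => continuous f /\
      forall i, (forall x, derivable f x (delta_mx ord0 i)) /\
                Ck k' (partial i f)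
  end.

End calculus.

(* Total degree; equal to (msize p).-1. *)
Definition mpoly_deg n (R : nzRingType) (p : mpoly.mpoly n R) : nat :=
  \max_(m <- mpoly.msupp p) mpoly.mdeg m.

(* Main.v *)
(* The spectral gap argument is replaced by an elementary one valid in [0, +oo].
   In dimension one, for y < x, pointwise
     (f x - f y)^2 <= (x - y) * \int_y^x f'^2
       <= (f x - f y)^2 + 1/2 * \int_y^x (x-u) * (u-y) * (x-y) * f''(u)^2 du,
   and integrating against gamma(dx) gamma(dy) turns both kernels into the
   Gaussian density, by Tonelli. Hence Var f <= E f'^2 <= Var f + 1/2 * E f''^2,
   where Var f = 1/2 * E (f x - f y)^2 needs no integrability. Both inequalities
   tensorize through an identity between squares of differences of f at
   (x, y), (x', y), (x, y'), (x', y'): the defect in the second one is a mixed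
   second difference, which the first inequality, applied in each variable,
   bounds by the mixed derivatives. For equality, Var f + 1/2 * E |Hess f|^2 -
   E |grad f|^2 is a nonnegative quadratic form, so by the parallelogram law
   its null functions form a subspace, and it vanishes on 1, x_i, x_i * x_j and
   x_i^2 - 1. *)
Require Import Defs.
From mathcomp Require Import all_boot all_order all_algebra.
From mathcomp Require Import all_classical all_reals all_analysis.
From mathcomp Require Import measurable_realfun ring lra.
From mathcomp.multinomials Require mpoly.
Import Order.TTheory GRing.Theory Num.Theory.
Import numFieldNormedType.Exports.
Set Implicit Arguments.
Unset Strict Implicit.
Unset Printing Implicit Defensive.
Local Open Scope classical_set_scope.
Local Open Scope ring_scope.

(** * Increments of a function of one real variable *)

(** The kernel of the second inequality on the line, with its constant 1/2, comes from the Legendre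
    operator. The quantity [(x - y) * \int_y^x f'^2 - (f x - f y)^2] is (x - y)^2 times the variance
    of f' under the uniform law on [y, x]. For the weight (x - u) * (u - y), the best Poincaré
    constant of that law is 1/2, the inverse of the spectral gap 2 of the Legendre operator, with
    equality when f' is affine; this is why quadratic polynomials lose nothing. Both kernels
    integrate explicitly because x - y = (x - u) + (u - y) turns them into sums of products of a
    function of x and a function of y. The value +oo shapes the statements: nothing is known
    beforehand about the gradient energy, so the inequalities between integrals are written as sums
    without subtraction, and they carry a factor 2 because [sqincr] is twice the variance.
    Finiteness of the gradient energy is then a consequence of the inequality. Off the diagonal of
    the Hessian, two uses of the first inequality bound the mean square of the mixed difference by 4
    times that of one mixed derivative; this fits the Hilbert-Schmidt norm, which counts each pair
    of indices twice. *)

Section one_dim.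
Context {R : realType}.
Implicit Types (f g h F G : R -> R) (x y z : R).

Lemma is_derive_continuous f g : (forall x, is_derive x 1 f (g x)) ->
  continuous f.
Proof.
by move=> fg x; apply: differentiable_continuous; apply/derivable1_diffP;
  case: (fg x).
Qed.

(** The pointwise inequalities below are obtained by differentiating in the right endpoint, so that
    only derivatives of expressions in primitives are computed and no integral is expanded. *)
Lemma derive_ge0_ge0 F G a x : (forall z, a <= z -> is_derive z 1 F (G z)) ->
  (forall z, a <= z -> 0 <= G z) -> 0 <= F a -> a <= x -> 0 <= F x.
Proof.
move=> dF G0 Fa ax; have [c] : exists2 c, c \in `[a, x]%R &
    F x - F a = G c * (x - a).
  apply: MVT_segment => //.
    by move=> z; rewrite in_itv/= => /andP[/ltW az _]; exact: dF.
  apply: derivable_within_continuous => z; rewrite in_itv/= => /andP[az _].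
  by case: (dF z az).
rewrite in_itv/= => /andP[ac _] FxE.
rewrite -(subrK (F a) (F x)) FxE addr_ge0// mulr_ge0 ?subr_ge0//.
exact: G0.
Qed.

(** Cauchy-Schwarz on [y, x], with [F] in the role of the integral of [g ^+ 2]: the integral of
    [(g - c) ^+ 2] is nonnegative, and taking for [c] the mean slope of [f] gives the sharp
    bound. *)
Lemma sqr_increment_le f g F y x : (forall z, is_derive z 1 f (g z)) ->
  (forall z, y <= z -> is_derive z 1 F (g z ^+ 2)) -> F y = 0 -> y <= x ->
  (f x - f y) ^+ 2 <= (x - y) * F x.
Proof.
move=> df dF Fy yx; have [->|xy] := eqVneq y x;
  first by rewrite !subrr expr0n mul0r.
have xy0 : x - y != 0 by rewrite subr_eq0 eq_sym.
pose c := (f x - f y) / (x - y).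
have /(_ x yx) : forall z, y <= z ->
    0 <= F z - 2 * c * (f z - f y) + c ^+ 2 * (z - y).
  move=> z yz.
  apply: (@derive_ge0_ge0 (fun z => F z - 2 * c * (f z - f y) + c ^+ 2 *
    (z - y))
     (fun z => (g z - c) ^+ 2) y) => //.
  - move=> t yt; have ? := dF t yt; have ? := df t.
    apply: is_derive_eq; rewrite /GRing.scale/=. ring.
  - by move=> t _; exact: sqr_ge0.
  - by rewrite Fy !subrr !mulr0 subrr addr0.
have -> : F x - 2 * c * (f x - f y) + c ^+ 2 * (x - y) =
  ((x - y) * F x - (f x - f y) ^+ 2) / (x - y) by rewrite /c; field.
rewrite pmulr_lge0 ?invr_gt0 ?subr_ge0// subr_gt0 lt_neqAle xy; exact: yx.
Qed.

(* Both sides vanish to second order at [x = y], and the second derivative in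
   [x] of the difference is twice the integral over [y, x] of
   [(z - y) * (h z - h x) ^+ 2]. *)
Lemma sqr_increment_ge f g h A M1 M2 y x :
  (forall z, is_derive z 1 f (g z)) -> (forall z, is_derive z 1 g (h z)) ->
  (forall z, y <= z -> is_derive z 1 A (g z ^+ 2)) ->
  (forall z, y <= z -> is_derive z 1 M1 ((z - y) * h z ^+ 2)) ->
  (forall z, y <= z -> is_derive z 1 M2 ((z - y) ^+ 2 * h z ^+ 2)) ->
  A y = 0 -> M1 y = 0 -> M2 y = 0 -> y <= x ->
  2 * ((x - y) * A x) <=
  2 * (f x - f y) ^+ 2 + (x - y) * ((x - y) * M1 x - M2 x).
Proof.
move=> df dg dA dM1 dM2 Ay M1y M2y.
(* [T] is half the derivative of [K] below, and [T'] is the derivative of [T]. *)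
pose T z := (z - y) * M1 z - M2 z / 2 - (A z + (z - y) * g z ^+ 2 -
  2 * g z * (f z - f y)).
pose T' z := M1 z - 2 * h z * ((z - y) * g z - (f z - f y)) +
  h z ^+ 2 * (z - y) ^+ 2 / 2.
have dT z : y <= z -> is_derive z 1 T (T' z).
  move=> yz; have ? := df z; have ? := dg z.
  have ? := dA _ yz; have ? := dM1 _ yz; have ? := dM2 _ yz.
  by apply: is_derive_eq; rewrite /T' /GRing.scale/=; field.
have T'0 x' : y <= x' -> 0 <= T' x'.
  (* Freezing [h x'] as a constant allows differentiation in [z]. The claim becomes that the
     integral of [(u - y) * (h u - c) ^+ 2] over [y, z] is nonnegative, because [(u - y) * h u]
     integrates by parts to [(z - y) * g z - (f z - f y)]. *)
  pose c := h x'.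
  suff : forall z, y <= z -> 0 <= M1 z - 2 * c * ((z - y) * g z - (f z - f y)) +
    c ^+ 2 * (z - y) ^+ 2 / 2 by exact.
  move=> z; apply: (@derive_ge0_ge0 (fun z => M1 z -
    2 * c * ((z - y) * g z - (f z - f y)) + c ^+ 2 * (z - y) ^+ 2 / 2)
    (fun z => (z - y) * (h z - c) ^+ 2)).
  - move=> t yt; have ? := df t; have ? := dg t; have ? := dM1 _ yt.
    by apply: is_derive_eq; rewrite /GRing.scale/=; field.
  - by move=> t yt; rewrite mulr_ge0 ?sqr_ge0 ?subr_ge0.
  - by rewrite M1y !subrr !mul0r subrr expr0n /= !mulr0 subr0 mul0r add0r.
have T0 z : y <= z -> 0 <= T z.
  apply: (derive_ge0_ge0 dT) => //.
  by rewrite /T Ay M1y M2y !subrr !mul0r !mulr0 !subr0 !addr0 subrr.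
move=> yx; rewrite -subr_ge0.
pose K z := 2 * (f z - f y) ^+ 2 + (z - y) * ((z - y) * M1 z - M2 z) -
   2 * ((z - y) * A z).
rewrite -[X in 0 <= X]/(K x).
have dK z : y <= z -> is_derive z 1 K (2 * T z).
  move=> yz; have ? := df z; have ? := dg z.
  have ? := dA _ yz; have ? := dM1 _ yz; have ? := dM2 _ yz.
  by apply: is_derive_eq; rewrite /T /GRing.scale/=; field.
apply: (derive_ge0_ge0 dK) yx.
- by move=> z yz; rewrite mulr_ge0// T0.
- by rewrite /K !subrr !mul0r expr0n !mulr0 addr0 subrr.
Qed.

Notation mu := (@lebesgue_measure R).

Lemma exists_primitive h y : continuous h ->
  exists2 H, H y = 0 & forall z, y <= z -> is_derive z 1 H (h z).
Proof.
(* The integral starts at [y - 1] so that [y] is an interior point and has a two-sided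
   derivative. *)
move=> ch; pose H0 z := (\int[mu]_(t in `[y - 1, z]) h t)%R.
exists (fun z => H0 z - H0 y); first by rewrite subrr.
move=> z yz; have yz1 : y - 1 < z by rewrite (lt_le_trans _ yz)// ltrBlDr ltrDl.
have ih : mu.-integrable `[y - 1, z + 1] (EFin \o h).
  apply: continuous_compact_integrable; first exact: segment_compact.
  exact: continuous_subspaceT.
have zz1 : z < z + 1 by rewrite ltrDl.
have [dH0 H0E] := continuous_FTC1_closed zz1 ih yz1 (ch z).
have ? : is_derive z 1 H0 (h z) by split; [exact: dH0|rewrite -derive1E].
by apply: is_derive_eq; rewrite subr0.
Qed.

Lemma integral_primitive h H y x : continuous h ->
  (forall z, y <= z -> is_derive z 1 H (h z)) -> y <= x ->
  (\int[mu]_(t in `[y, x]) (h t)%:E = (H x - H y)%:E)%E.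
Proof.
move=> ch dH; rewrite le_eqVlt => /predU1P[->|yx].
  by rewrite set_itv1 integral_set1 subrr.
rewrite EFinB; apply: continuous_FTC2 => //.
- exact: continuous_subspaceT.
- have cH z : y <= z -> {for z, continuous H}.
    move=> /dH dHz; apply: differentiable_continuous; apply/derivable1_diffP.
    by case: dHz.
  split.
  + by move=> z; rewrite in_itv/= => /andP[/ltW /dH[]].
  + by apply: cvg_at_right_filter; exact: cH.
  + by apply: cvg_at_left_filter; apply: cH; exact: ltW.
- move=> z; rewrite in_itv/= => /andP[/ltW yz _]; rewrite derive1E.
  by have ? := dH z yz; rewrite derive_val.
Qed.

End one_dim.

(** * Gaussian integrals on the line *)

Section integral_inequalities.
Context d (T : measurableType d) (R : realType) (m : {measure set T -> \bar R}).
Local Open Scope ereal_scope.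
Variables (c : R) (f g h : T -> \bar R).
Hypothesis c0 : (0 <= c)%R.
Hypotheses (mf : measurable_fun [set: T] f) (f0 : forall x, 0 <= f x).
Hypotheses (mg : measurable_fun [set: T] g) (g0 : forall x, 0 <= g x).
Hypotheses (mh : measurable_fun [set: T] h) (h0 : forall x, 0 <= h x).

Lemma ge0_le_integralZl : (forall x, f x <= c%:E * g x) ->
  \int[m]_x f x <= c%:E * \int[m]_x g x.
Proof.
move=> fg; rewrite -ge0_integralZl ?lee_fin//.
by apply: ge0_le_integral => //; exact: measurable_funeM.
Qed.

Lemma ge0_le_integralDZ : (forall x, c%:E * f x <= g x + h x) ->
  c%:E * \int[m]_x f x <= \int[m]_x g x + \int[m]_x h x.
Proof.
move=> fgh; rewrite -ge0_integralZl ?lee_fin// -ge0_integralD//.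
apply: ge0_le_integral => //.
- by move=> x _; rewrite mule_ge0 ?lee_fin.
- exact: measurable_funeM.
- exact: emeasurable_funD.
Qed.

End integral_inequalities.

(** * Integration against a measure given by a density *)

Section density.
Context d (T : measurableType d) (R : realType).
Variables (mu nu : {measure set T -> \bar R}) (g : T -> R).
Hypothesis mg : measurable_fun [set: T] g.
Hypothesis g0 : forall x, 0 <= g x.
Hypothesis nuE : forall A, measurable A ->
  nu A = (\int[mu]_(x in A) (g x)%:E)%E.
Local Open Scope ereal_scope.
Import HBNNSimple.

Let integral_density_nnsfun (h : {nnsfun T >-> R}) :
  \int[nu]_x (h x)%:E = \int[mu]_x ((h x)%:E * (g x)%:E).
Proof.
have mEg : measurable_fun [set: T] (EFin \o g) by exact/measurable_EFinP.
have hE x : (h x)%:E = \sum_(r \in range h) (r * \1_(h @^-1` [set r]) x)%:E.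
  by rewrite fimfunE -fsumEFin.
have mi r : measurable_fun [set: T] (fun x => (r * \1_(h @^-1` [set r]) x)%:E).
  by apply/measurable_EFinP; exact: measurable_funM.
transitivity (\sum_(r \in range h)
    \int[nu]_x (r * \1_(h @^-1` [set r]) x)%:E).
  under eq_integral do rewrite hE.
  by rewrite ge0_integral_fsum// => r x _; exact: nnfun_muleindic_ge0.
transitivity (\sum_(r \in range h)
    \int[mu]_x ((r * \1_(h @^-1` [set r]) x)%:E * (g x)%:E)); last first.
  rewrite -ge0_integral_fsum//.
  - apply: eq_integral => x _; rewrite hE ge0_mule_fsuml// => r.
    exact: nnfun_muleindic_ge0.
  - by move=> r; exact: emeasurable_funM.
  - by move=> r x _; rewrite mule_ge0 ?lee_fin//; exact: nnfun_muleindic_ge0.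
apply: eq_fsbigr => r /set_mem[x0 _ hx0].
have r0 : (0 <= r)%R by rewrite -hx0.
under eq_integral do rewrite EFinM.
rewrite ge0_integralZl//=; last exact/measurable_EFinP.
rewrite integral_indic// setIT nuE//.
under [RHS]eq_integral do rewrite EFinM -muleA.
rewrite [RHS]ge0_integralZl//=; first last.
- by move=> x _; rewrite mule_ge0 ?lee_fin.
- by apply: emeasurable_funM => //; exact/measurable_EFinP.
congr (_ * _); rewrite [LHS]integral_mkcond; apply: eq_integral => x _.
by rewrite patchE indicE; case: ifPn; rewrite ?mul1e ?mul0e.
Qed.

(** Monotone convergence from simple functions. The hypothesis [nuE] is the form in which both
    [normal_prob] and [gauss] are defined, so the lemma serves on the line and on row vectors. *)
Lemma ge0_integral_density f : measurable_fun [set: T] f ->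
  (forall x, 0 <= f x) -> \int[nu]_x f x = \int[mu]_x (f x * (g x)%:E).
Proof.
move=> mf f0; pose h := nnsfun_approx measurableT mf.
have hf x : (h n x)%:E @[n --> \oo] --> f x.
  exact: (cvg_nnsfun_approx measurableT mf (fun x _ => f0 x)).
have ndh x m n : (m <= n)%N -> ((h m x)%:E <= (h n x)%:E).
  by move=> mn; rewrite lee_fin; exact/lefP/nd_nnsfun_approx.
transitivity (limn (fun n => \int[nu]_x (h n x)%:E)).
  rewrite -monotone_convergence//.
  - by apply: eq_integral => x _; apply/esym/cvg_lim.
  - by move=> n; exact/measurable_EFinP.
  - by move=> n x _; rewrite lee_fin.
  - by move=> x _ m n mn; exact: ndh.
transitivity (limn (fun n => \int[mu]_x ((h n x)%:E * (g x)%:E))).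
  by congr (limn _); apply/funext => n; exact: integral_density_nnsfun.
rewrite -monotone_convergence//.
- apply: eq_integral => x _; apply/cvg_lim => //.
  by apply: cvgeZr => //; exact: hf.
- by move=> n; apply: emeasurable_funM; exact/measurable_EFinP.
- by move=> n x _; apply: mule_ge0; rewrite lee_fin.
- by move=> x _ m n mn; apply: lee_wpmul2r; [rewrite lee_fin|exact: ndh].
Qed.
End density.

Section normal.
Context {R : realType}.
Notation mu := (@lebesgue_measure R).
Notation phi := (@normal_pdf R 0 1).
Notation gam := (@normal_prob R 0 1).
Local Open Scope ereal_scope.

Lemma ge0_integral_normal (f : R -> \bar R) : measurable_fun [set: R] f ->
  (forall x, 0 <= f x) ->
  \int[gam]_x f x = \int[mu]_x (f x * (phi x)%:E).
Proof.
move=> mf f0; apply: (@ge0_integral_density _ _ _ mu gam phi) => //;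
  first exact: measurable_normal_pdf.
by move=> x; exact: normal_pdf_ge0.
Qed.

Lemma normal_pdf01E : phi = fun x => (normal_peak 1 * expR (- (x ^+ 2 / 2)))%R.
Proof.
apply/funext => x; rewrite normal_pdfE ?oner_neq0//.
by rewrite /normal_fun subr0 expr1n mulNr.
Qed.

Lemma normal_pdfN x : phi (- x)%R = phi x.
Proof. by rewrite normal_pdf01E sqrrN. Qed.

Lemma is_derive_normal_pdf (x : R) : is_derive x (1 : R)%R phi (- x * phi x)%R.
Proof.
rewrite normal_pdf01E; apply: is_derive_eq.
by rewrite /GRing.scale/=; field.
Qed.

Lemma continuous_phi : continuous phi.
Proof. by apply: continuous_normal_pdf; exact: oner_neq0. Qed.

Lemma ge0_integral_normalN (f : R -> \bar R) : measurable_fun [set: R] f ->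
  (forall x, 0 <= f x) -> \int[gam]_x f (- x)%R = \int[gam]_x f x.
Proof.
move=> mf f0; have mN : measurable_fun [set: R] (-%R : R -> R) by [].
have mfN : measurable_fun [set: R] (fun x => f (- x)%R).
  exact: (measurableT_comp mf mN).
have mphi : measurable_fun [set: R] (EFin \o phi).
  by apply/measurable_EFinP; exact: measurable_normal_pdf.
rewrite !ge0_integral_normal//.
pose F x := f x * (phi x)%:E.
have mF : measurable_fun [set: R] F by exact: emeasurable_funM.
have -> : \int[mu]_x (f (- x)%R * (phi x)%:E) = \int[mu]_x (F \o -%R) x.
  by apply: eq_integral => x _ /=; rewrite /F normal_pdfN.
rewrite -(preimage_setT (-%R : R -> measurableTypeR R)).
rewrite -ge0_integral_pushforward//.
  by apply: eq_measure_integral => A mA _; exact: lebesgue_measureN.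
by move=> x _; rewrite /F mule_ge0// lee_fin normal_pdf_ge0.
Qed.

End normal.

(** * Truncated powers and Gaussian tails *)

Section tails.
Context {R : realType}.
Notation mu := (@lebesgue_measure R).
Notation phi := (@normal_pdf R 0 1).
Notation gam := (@normal_prob R 0 1).

(** The truncated powers of x - t and t - x. A product of an [rtail] in [x] and an [ltail] in [y] is
    supported on y <= t <= x and separates the two variables, which makes the kernels explicitly
    integrable. For k = 0 both are indicators of closed half-lines, overlapping at [t]. *)
Definition rtail k (t x : R) : R := if t <= x then (x - t) ^+ k else 0.
Definition ltail k (t x : R) : R := if x <= t then (t - x) ^+ k else 0.

Lemma rtail_ge0 k t x : 0 <= rtail k t x.
Proof. by rewrite /rtail; case: ifPn => // tx; rewrite exprn_ge0 ?subr_ge0. Qed.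

Lemma ltail_ge0 k t x : 0 <= ltail k t x.
Proof. by rewrite /ltail; case: ifPn => // tx; rewrite exprn_ge0 ?subr_ge0. Qed.

Lemma ltailE k t x : ltail k t x = rtail k (- t) (- x).
Proof. by rewrite /ltail /rtail lerN2 opprK addrC. Qed.

Lemma measurable_rtail k :
  measurable_fun [set: R * R] (fun p => rtail k p.1 p.2).
Proof.
apply: measurable_fun_ifT => //=.
- by apply: measurable_fun_ler.
- by apply: measurable_funX; exact: measurable_funB.
Qed.

Lemma measurable_ltail k :
  measurable_fun [set: R * R] (fun p => ltail k p.1 p.2).
Proof.
apply: measurable_fun_ifT => //=.
- by apply: measurable_fun_ler.
- by apply: measurable_funX; exact: measurable_funB.
Qed.

Definition gauss_tail (t : R) : R :=
  fine (\int[mu]_(x in `[t, +oo[) (phi x)%:E)%E.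

Lemma integral_gauss_tail t :
  (\int[mu]_(x in `[t, +oo[) (phi x)%:E)%E = (gauss_tail t)%:E.
Proof.
rewrite /gauss_tail fineK//; apply: integrable_fin_num => //.
exact: integrableS (integrable_normal_pdf 0 1).
Qed.

(** The function [Q] stands for [gauss_tail] on the half-line from [t]. Building it from a primitive
    of [phi] avoids differentiating an improper integral. *)
Lemma gauss_tail_primitive (t : R) : exists Q : R -> R,
  [/\ forall z : R, t <= z -> is_derive z 1 Q (- phi z),
      Q x @[x --> +oo%R] --> 0 & Q t = gauss_tail t].
Proof.
have [H Ht dH] := exists_primitive t (@continuous_phi R).
have HE z : t <= z -> ((H z)%:E = \int[mu]_(x in `[t, z]) (phi x)%:E)%E.
  move=> tz; rewrite (integral_primitive (@continuous_phi R) dH tz) Ht subr0//.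
have H1 z : t <= z -> H z <= gauss_tail t.
  move=> tz; rewrite -lee_fin HE// -integral_gauss_tail.
  apply: ge0_subset_integral => //.
  - apply/measurable_EFinP; apply: measurable_funTS;
      exact: measurable_normal_pdf.
  - by move=> x _; rewrite lee_fin normal_pdf_ge0.
  - by apply: subset_itvl; rewrite bnd_simp.
have ndH x y : t <= x -> x <= y -> H x <= H y.
  move=> tx xy; rewrite -subr_ge0;
    apply: (@derive_ge0_ge0 _ (fun y => H y - H x) phi x) => //.
  - move=> z xz; have ? := dH _ (le_trans tx xz).
    by apply: is_derive_eq; rewrite subr0.
  - by move=> z _; exact: normal_pdf_ge0.
  - by rewrite subrr.
have cH z : t <= z -> {for z, continuous H}.
  by move=> tz; apply: differentiable_continuous; apply/derivable1_diffP;
    case: (dH _ tz).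
(* [H] is controlled only to the right of [t]; truncating its argument gives a function that is
   monotone and bounded on the whole line, hence convergent at infinity. *)
pose K z := H (Num.max t z).
have [l Hl] : exists l : R, K x @[x --> +oo%R] --> l.
  have ndK : nondecreasing_fun K.
    move=> x y xy; apply: ndH; first by rewrite le_max lexx.
    by rewrite ge_max !le_max lexx/= xy orbT.
  have ubK : has_ubound (range K).
    exists (gauss_tail t) => _ [z _ <-]; apply: H1.
    by rewrite le_max lexx.
  exists (sup (range K)); exact: (nondecreasing_cvgr ndK ubK).
have {}Hl : H x @[x --> +oo%R] --> l.
  apply: cvg_trans Hl; apply: near_eq_cvg; near=> z.
  by rewrite /K max_r//; near: z; apply: nbhs_pinfty_ge; rewrite num_real.
have lE : l = gauss_tail t.
  apply: EFin_inj; rewrite -integral_gauss_tail.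
  rewrite (@ge0_continuous_FTC2y _ phi H t l) ?Ht ?sube0//.
  - by move=> x _; exact: normal_pdf_ge0.
  - by apply: continuous_subspaceT; exact: continuous_phi.
  - by move=> x tx; case: (dH _ (ltW tx)).
  - by apply: cvg_at_right_filter; rewrite -Ht; exact: cH.
  - move=> z; rewrite in_itv/= andbT => /ltW tz; rewrite derive1E.
    by have ? := dH _ tz; rewrite derive_val.
exists (fun z => gauss_tail t - H z); split.
- move=> z tz; have ? := dH _ tz.
  by apply: is_derive_eq; rewrite add0r mul1r.
- by rewrite -lE -(subrr l); apply: cvgB => //; exact: cvg_cst.
- by rewrite Ht subr0.
Unshelve. all: by end_near. Qed.

(** Squaring exp(u) >= u at u = x^2 / 4 bounds [phi x] by a multiple of x^-4, one power more than
    [p] can absorb. Cubic growth is what the fourth moment requires. *)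
Lemma cvg_cubic_mul_normal (p : R -> R) (C : R) :
  (forall x, 1 <= x -> `|p x| <= C * x ^+ 3) ->
  p x * phi x @[x --> +oo%R] --> 0.
Proof.
move=> pC; have phi16 x : 0 < x -> phi x <= normal_peak 1 * 16 * x ^- 4.
  move=> x0; rewrite normal_pdf01E -mulrA ler_wpM2l ?normal_peak_ge0//.
  rewrite expRN -[leRHS]invrK lef_pV2 ?posrE ?expR_gt0 ?invr_gt0 ?mulr_gt0
    ?invr_gt0 ?exprn_gt0//.
  rewrite invfM invrK.
  have -> : x ^+ 2 / 2 = x ^+ 2 / 4 + x ^+ 2 / 4 by field.
  rewrite expRD; apply: (@le_trans _ _ ((x ^+ 2 / 4) * (x ^+ 2 / 4))).
    by rewrite le_eqVlt; apply/orP; left; apply/eqP; field.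
  have h0 : 0 <= x ^+ 2 / 4 by rewrite divr_ge0 ?sqr_ge0.
  have h1 : x ^+ 2 / 4 <= expR (x ^+ 2 / 4).
    by rewrite (le_trans _ (expR_ge1Dx _))// lerDr.
  exact: ler_pM.
have C0 : 0 <= C.
  by have := pC _ (lexx 1); rewrite expr1n mulr1; exact: le_trans.
pose D := C * (normal_peak 1 * 16).
have bnd : \forall x \near +oo%R, `|p x * phi x| <= D * x^-1.
  near=> x; have x1 : 1 <= x by near: x; apply: nbhs_pinfty_ge;
    rewrite num_real.
  have x0 : 0 < x by rewrite (lt_le_trans ltr01).
  rewrite normrM (ger0_norm (normal_pdf_ge0 _ _ _)).
  apply: (@le_trans _ _ (C * x ^+ 3 * (normal_peak 1 * 16 * x ^- 4))).
    by apply: ler_pM; rewrite ?normal_pdf_ge0 ?pC ?phi16.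
  by rewrite le_eqVlt; apply/orP; left; apply/eqP; rewrite /D; field;
    rewrite gt_eqF.
have cD : D * x^-1 @[x --> +oo%R] --> 0.
  rewrite -(mulr0 D); apply: cvgM; first exact: cvg_cst.
  apply/gtr0_cvgV0; last exact: cvg_id.
  by near=> x; near: x; apply: nbhs_pinfty_gt; rewrite num_real.
apply/norm_cvg0P.
apply: (@squeeze_cvgr _ _ _ _ (cst 0) (fun x => D * x^-1)); last 2 first.
  exact: cvg_cst.
  exact: cD.
by near=> x; apply/andP; split; [exact: normr_ge0|near: x].
Unshelve. all: by end_near. Qed.

(** Gaussian integration by parts: [p * phi] has derivative [(p' - x * p) * phi], and [c] collects
    the constant left over when a polynomial is written as [p' - x * p]. The primitive is
    [p * phi + c * Q], with [Q] the tail function that vanishes at infinity. *)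
Lemma integral_itvy_normal (p p' : R -> R) (c C t : R) :
  (forall x : R, is_derive x 1 p (p' x)) -> continuous p' ->
  (forall x, 1 <= x -> `|p x| <= C * x ^+ 3) ->
  (forall x, t <= x -> 0 <= p' x - x * p x - c) ->
  (\int[mu]_(x in `[t, +oo[) ((p' x - x * p x - c) * phi x)%:E)%E =
  (- (p t * phi t) - c * gauss_tail t)%:E.
Proof.
move=> dp cp' pC w0; have [Q [dQ Q0 Qt]] := gauss_tail_primitive t.
pose F x := p x * phi x + c * Q x.
have cp := is_derive_continuous dp.
have dF x : t <= x -> is_derive x 1 F ((p' x - x * p x - c) * phi x).
  move=> tx; have ? := dp x; have ? := dQ _ tx; have ? :=
    is_derive_normal_pdf x.
  by apply: is_derive_eq; rewrite /GRing.scale/=; ring.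
have cF : {for t, continuous F}.
  apply: differentiable_continuous; apply/derivable1_diffP.
  by case: (dF _ (lexx t)).
rewrite (@ge0_continuous_FTC2y _ _ F t 0).
- by rewrite sub0e -EFinN /F Qt opprD.
- by move=> x tx; rewrite mulr_ge0 ?w0 ?normal_pdf_ge0.
- apply: continuous_subspaceT => x; apply: cvgM; last exact: continuous_phi.
  apply: cvgB; last exact: cvg_cst.
  by apply: cvgB; [exact: cp'|apply: cvgM; [exact: cvg_id|exact: cp]].
- rewrite -[X in _ --> X](addr0 0) -[X in _ --> _ + X](mulr0 c).
  apply: cvgD; first exact: cvg_cubic_mul_normal pC.
  by apply: cvgM; [exact: cvg_cst|exact: Q0].
- by move=> x tx; case: (dF _ (ltW tx)).
- exact: cvg_at_right_filter.
- move=> z; rewrite in_itv/= andbT => /ltW tz; rewrite derive1E.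
  by have ? := dF _ tz; rewrite derive_val.
Qed.

End tails.

Section kernel.
Context d1 (X : measurableType d1) d2 (Y : measurableType d2)
  d (T : measurableType d) (R : realType).
Variables (m1 : {sigma_finite_measure set X -> \bar R})
  (m2 : {sigma_finite_measure set Y -> \bar R})
  (m : {sigma_finite_measure set T -> \bar R}).
Variable K : X * T * Y -> \bar R.
Hypotheses (mK : measurable_fun [set: X * T * Y] K) (K0 : forall p,
  (0 <= K p)%E).
Local Open Scope ereal_scope.

(** The kernels arise with [t] innermost, as integrals over [y, x]; their evaluation needs [t]
    outermost. Two exchanges suffice: [t] with [y] for fixed [x], then [t] with [x]. *)
Lemma fubini_tonelli_rot : \int[m1]_x \int[m2]_y \int[m]_t K (x, t, y) =
  \int[m]_t \int[m1]_x \int[m2]_y K (x, t, y).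
Proof.
pose f p := \int[m2]_y K (p, y).
rewrite -(@fubini_tonelli _ _ _ _ _ m1 m f).
- apply: eq_integral => x _.
  rewrite (@fubini_tonelli _ _ _ _ _ m2 m (fun q => K (x, q.2, q.1)))//.
  apply: (measurableT_comp mK); do 2?apply: measurable_fun_pair => //.
- exact: (@measurable_fun_fubini_tonelli_F _ _ _ _ _ m2 K).
- by move=> p; exact: integral_ge0.
Qed.

End kernel.

Section weights.
Context {R : realType}.
Notation mu := (@lebesgue_measure R).
Notation phi := (@normal_pdf R 0 1).
Notation gam := (@normal_prob R 0 1).

Lemma integral_rtail k t : (\int[gam]_x (rtail k t x)%:E =
  \int[mu]_(x in `[t, +oo[) ((x - t) ^+ k * phi x)%:E)%E.
Proof.
rewrite ge0_integral_normal.
- rewrite [RHS]integral_mkcond; apply: eq_integral => x _.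
  rewrite patchE mem_setE in_itv/= andbT /rtail.
  by case: ifPn; rewrite ?mul0e// EFinM.
- apply/measurable_EFinP.
  exact: (measurableT_comp (measurable_rtail k) (measurable_pair1 t)).
- by move=> x; rewrite lee_fin rtail_ge0.
Qed.

Lemma integral_ltail k t :
  (\int[gam]_x (ltail k t x)%:E = \int[gam]_x (rtail k (- t) x)%:E)%E.
Proof.
rewrite -[RHS]ge0_integral_normalN.
- by apply: eq_integral => x _; rewrite ltailE.
- apply/measurable_EFinP.
  exact: (measurableT_comp (measurable_rtail k) (measurable_pair1 (- t))).
- by move=> x; rewrite lee_fin rtail_ge0.
Qed.

Lemma integral_rtail0 t : (\int[gam]_x (rtail 0 t x)%:E = (gauss_tail t)%:E)%E.
Proof.
rewrite integral_rtail -integral_gauss_tail.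
by apply: eq_integral => x _; rewrite expr0 mul1r.
Qed.

Lemma integral_rtail1 t :
  (\int[gam]_x (rtail 1 t x)%:E = (phi t - t * gauss_tail t)%:E)%E.
Proof.
rewrite integral_rtail.
transitivity (\int[mu]_(x in `[t, +oo[) ((0 - x * -1 - t) * phi x)%:E)%E.
  by apply: eq_integral => x _; congr (EFin (_ * _)); ring.
rewrite (@integral_itvy_normal _ (cst (-1)) (cst 0) t 1).
- by congr EFin; rewrite /=; ring.
- exact: cst_continuous.
- by move=> x x1; rewrite /= normrN1 mul1r exprn_ege1.
- by move=> x /= tx; lra.
Qed.

Lemma integral_rtail2 t : (\int[gam]_x (rtail 2 t x)%:E =
  ((1 + t ^+ 2) * gauss_tail t - t * phi t)%:E)%E.
Proof.
rewrite integral_rtail.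
(* For p = 2 * t - x, the expression p' - x * p equals x^2 - 2 * t * x - 1, and c = - 1 - t^2
   completes the square (x - t)^2. *)
transitivity (\int[mu]_(x in `[t, +oo[)
    ((-1 - x * (2 * t - x) - (- 1 - t ^+ 2)) * phi x)%:E)%E.
  by apply: eq_integral => x _; congr (EFin (_ * _)); ring.
have dp (x : R) : is_derive x 1 (fun x => 2 * t - x) (cst (-1) x).
  by apply: is_derive_eq; rewrite /= add0r mul1r.
rewrite (@integral_itvy_normal _ (fun x => 2 * t - x) (cst (-1)) (- 1 - t ^+ 2)
  (2 * `|t| + 1)).
- by congr EFin; rewrite /=; ring.
- exact: cst_continuous.
- move=> x x1 /=; rewrite (le_trans (ler_normB _ _))//.
  rewrite [leRHS]mulrDl normrM (ger0_norm (ler0n _ 2)).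
  have x3 : x <= x ^+ 3 by rewrite -[leLHS]expr1; apply: ler_weXn2l.
  rewrite lerD//; last by rewrite mul1r ger0_norm// (le_trans ler01 x1).
  by rewrite ler_peMr ?mulr_ge0// exprn_ege1.
- by move=> x /= tx; have := sqr_ge0 (x - t); lra.
Qed.

Lemma gauss_tailN (t : R) : gauss_tail t + gauss_tail (- t) = 1.
Proof.
apply: EFin_inj; rewrite EFinD -!integral_rtail0 -integral_ltail.
have mr k : measurable_fun [set: R] (EFin \o rtail k t).
  apply/measurable_EFinP.
  exact: (measurableT_comp (measurable_rtail k) (measurable_pair1 t)).
have ml k : measurable_fun [set: R] (EFin \o ltail k t).
  apply/measurable_EFinP.
  exact: (measurableT_comp (measurable_ltail k) (measurable_pair1 t)).
rewrite -ge0_integralD//.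
(* The two closed half-lines cover the line and meet in the single point [t], which is a null
   set. *)
- transitivity (\int[gam]_(x in [set: R]) (1%:E + (\1_[set t] x)%:E))%E.
    apply: eq_integral => x _; rewrite /rtail /ltail !expr0 indicE -!EFinD.
    congr EFin; case: ltgtP => [tx|xt|->].
    - by rewrite memNset ?addr0// => /= xE; rewrite xE ltxx in tx.
    - by rewrite memNset ?addr0 ?add0r// => /= xE; rewrite xE ltxx in xt.
    - by rewrite mem_set.
  rewrite ge0_integralD//; last exact/measurable_EFinP.
  rewrite integral_cst//= integral_indic//= setIT mul1e.
  rewrite [X in (X + _)%E]probability_setT.
  suff -> : gam [set t] = 0%E by rewrite adde0.
  by rewrite /normal_prob integral_set1.
- by move=> x _; rewrite lee_fin rtail_ge0.
- exact: mr.
- by move=> x _; rewrite lee_fin ltail_ge0.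
- exact: ml.
Qed.

(* [W1] and [W2] say that, for fixed t, the Gaussian integrals over y < t < x of
   x - y and of (x - y) * (x - t) * (t - y) are both exactly phi t. *)
Let W1 (t : R) : (\int[gam]_x (rtail 1 t x)%:E * \int[gam]_y (ltail 0 t y)%:E +
  \int[gam]_x (rtail 0 t x)%:E * \int[gam]_y (ltail 1 t y)%:E = (phi t)%:E)%E.
Proof.
rewrite !integral_ltail !integral_rtail0 !integral_rtail1 -!EFinM -EFinD.
congr EFin; rewrite normal_pdfN -[RHS]mul1r -(gauss_tailN t); ring.
Qed.

Let W2 (t : R) : (\int[gam]_x (rtail 2 t x)%:E * \int[gam]_y (ltail 1 t y)%:E +
  \int[gam]_x (rtail 1 t x)%:E * \int[gam]_y (ltail 2 t y)%:E = (phi t)%:E)%E.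
Proof.
rewrite !integral_ltail !integral_rtail1 !integral_rtail2 -!EFinM -EFinD.
congr EFin; rewrite normal_pdfN -[RHS]mul1r.
have -> : gauss_tail (- t) = 1 - gauss_tail t by rewrite -(gauss_tailN t) addrC
  addKr.
ring.
Qed.

(** With [t] outermost, each product of tails separates into an integral in [x] times one in [y]. By
    [w] the two products add up to [phi t], and [F t * phi t] integrated against Lebesgue measure is
    the Gaussian integral of [F]. *)
Let kernel_sum (F : R -> R) i j k l : measurable_fun [set: R] F ->
  (forall t, 0 <= F t) ->
  (forall t : R, \int[gam]_x (rtail i t x)%:E * \int[gam]_y (ltail j t y)%:E +
  \int[gam]_x (rtail k t x)%:E * \int[gam]_y (ltail l t y)%:E = (phi t)%:E)%E ->
  (\int[gam]_x \int[gam]_y \int[mu]_t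
     (F t * (rtail i t x * ltail j t y + rtail k t x * ltail l t y))%:E =
   \int[gam]_t (F t)%:E)%E.
Proof.
move=> mF F0 w.
have mr n t : measurable_fun [set: R] (EFin \o rtail n t).
  apply/measurable_EFinP.
  exact: (measurableT_comp (measurable_rtail n) (measurable_pair1 t)).
have ml n t : measurable_fun [set: R] (EFin \o ltail n t).
  apply/measurable_EFinP.
  exact: (measurableT_comp (measurable_ltail n) (measurable_pair1 t)).
have r0 n t x : (0 <= (rtail n t x)%:E)%E by rewrite lee_fin rtail_ge0.
have l0 n t x : (0 <= (ltail n t x)%:E)%E by rewrite lee_fin ltail_ge0.
have mr' n : measurable_fun [set: R * R * R] (fun p => rtail n p.1.2 p.1.1).
  have mq : measurable_fun [set: R * R * R] (fun p => (p.1.2, p.1.1)).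
    by apply: measurable_fun_pair; exact: measurableT_comp.
  exact: (measurableT_comp (measurable_rtail n) mq).
have ml' n : measurable_fun [set: R * R * R] (fun p => ltail n p.1.2 p.2).
  have mq : measurable_fun [set: R * R * R] (fun p => (p.1.2, p.2)).
    by apply: measurable_fun_pair => //; exact: measurableT_comp.
  exact: (measurableT_comp (measurable_ltail n) mq).
rewrite (@fubini_tonelli_rot _ _ _ _ _ _ _ gam gam mu (fun p => (F p.1.2 *
  (rtail i p.1.2 p.1.1 * ltail j p.1.2 p.2 + rtail k p.1.2 p.1.1 * ltail l p.1.2
    p.2))%:E)).
- rewrite ge0_integral_normal//; last exact/measurable_EFinP.
  apply: eq_integral => t _; rewrite -w.
  transitivity (\int[gam]_x ((F t)%:E *
    ((rtail i t x)%:E * \int[gam]_y (ltail j t y)%:E +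
      (rtail k t x)%:E * \int[gam]_y (ltail l t y)%:E)))%E.
    apply: eq_integral => x _ /=.
    under eq_integral do rewrite EFinM EFinD !EFinM.
    rewrite ge0_integralZl//.
    + congr (_ * _)%E; rewrite ge0_integralD//.
      * by rewrite !ge0_integralZl//; [exact: ml|exact: ml].
      * by move=> y _; rewrite mule_ge0.
      * by apply: emeasurable_funM => //; exact: ml.
      * by move=> y _; rewrite mule_ge0.
      * by apply: emeasurable_funM => //; exact: ml.
    + by apply: emeasurable_funD; apply: emeasurable_funM => //; exact: ml.
    + by move=> y _; rewrite adde_ge0// mule_ge0.
    + by rewrite lee_fin.
  have L0 n : (0 <= \int[gam]_y (ltail n t y)%:E)%E by exact: integral_ge0.
  rewrite ge0_integralZl//.
  + congr (_ * _)%E; rewrite ge0_integralD//.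
    * by rewrite !ge0_integralZr//; [exact: mr|exact: mr].
    * by move=> x _; rewrite mule_ge0.
    * by apply: emeasurable_funM => //; exact: mr.
    * by move=> x _; rewrite mule_ge0.
    * by apply: emeasurable_funM => //; exact: mr.
  + by apply: emeasurable_funD; apply: emeasurable_funM => //; exact: mr.
  + by move=> x _; rewrite adde_ge0// mule_ge0.
  + by rewrite lee_fin.
- apply/measurable_EFinP; apply: measurable_funM.
    by apply: (measurableT_comp mF); exact: measurableT_comp.
  apply: measurable_funD; apply: measurable_funM.
  + exact: mr'.
  + exact: ml'.
  + exact: mr'.
  + exact: ml'.
- move=> p; rewrite lee_fin mulr_ge0// addr_ge0// mulr_ge0 ?rtail_ge0
    ?ltail_ge0//.
Qed.

Lemma integral_kernel1 (F : R -> R) : measurable_fun [set: R] F ->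
  (forall t, 0 <= F t) ->
  (\int[gam]_x \int[gam]_y \int[mu]_t
     (F t * (rtail 1 t x * ltail 0 t y + rtail 0 t x * ltail 1 t y))%:E =
   \int[gam]_t (F t)%:E)%E.
Proof. by move=> mF F0; apply: kernel_sum => // t; exact: W1. Qed.

Lemma integral_kernel2 (F : R -> R) : measurable_fun [set: R] F ->
  (forall t, 0 <= F t) ->
  (\int[gam]_x \int[gam]_y \int[mu]_t
     (F t * (rtail 2 t x * ltail 1 t y + rtail 1 t x * ltail 2 t y))%:E =
   \int[gam]_t (F t)%:E)%E.
Proof. by move=> mF F0; apply: kernel_sum => // t; exact: W2. Qed.

End weights.

(** * The inequalities in dimension one *)

Section one_dim_ineq.
Context {R : realType}.
Notation mu := (@lebesgue_measure R).
Notation phi := (@normal_pdf R 0 1).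
Notation gam := (@normal_prob R 0 1).

Lemma continuous_expr (u : R -> R) k : continuous u ->
  continuous (fun t => u t ^+ k).
Proof.
move=> cu t; exact: (continuous_comp (cu t) (@exprn_continuous R k (u t))).
Qed.

Lemma integral_kernel_itv (F w : R -> R) (x y : R) : y <= x ->
  (\int[mu]_t (F t * (if y <= t <= x then w t else 0))%:E =
   \int[mu]_(t in `[y, x]) (w t * F t)%:E)%E.
Proof.
move=> yx; rewrite [RHS]integral_mkcond; apply: eq_integral => t _.
rewrite patchE mem_setE in_itv/=.
by case: ifPn; rewrite ?mulr0// mulrC.
Qed.

Let tail_mul k l (t x y : R) : rtail k t x * ltail l t y =
  if y <= t <= x then (x - t) ^+ k * (t - y) ^+ l else 0.
Proof.
by rewrite /rtail /ltail andbC; case: ifP; rewrite ?mul0r//=; case: ifP;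
  rewrite ?mulr0.
Qed.

Let kernel1E (t x y : R) :
  rtail 1 t x * ltail 0 t y + rtail 0 t x * ltail 1 t y =
  if y <= t <= x then x - y else 0.
Proof. by rewrite !tail_mul; case: ifP => _; rewrite ?addr0//; ring. Qed.

Let kernel2E (t x y : R) :
  rtail 2 t x * ltail 1 t y + rtail 1 t x * ltail 2 t y =
  if y <= t <= x then (x - y) * ((x - y) * (t - y) - (t - y) ^+ 2) else 0.
Proof. by rewrite !tail_mul; case: ifP => _; rewrite ?addr0//; ring. Qed.

Variables (f g : R -> R).
Hypothesis df : forall x : R, is_derive x 1 f (g x).
Hypothesis cg : continuous g.

(** Cut to y <= x, where the pointwise inequalities hold; [symmetrize_increment] recovers the full
    square. *)
Let D x y : R := if y <= x then (f x - f y) ^+ 2 else 0.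

(** For y <= x this is (x - y) times the integral of [g ^+ 2] over [y, x], and it is 0 otherwise.
    The product form is the one that [integral_kernel1] evaluates. *)
Let I1 x y := (\int[mu]_t (g t ^+ 2 *
  (rtail 1 t x * ltail 0 t y + rtail 0 t x * ltail 1 t y))%:E)%E.

Let cg2 : continuous (fun t => g t ^+ 2).
Proof. exact: continuous_expr. Qed.

Let I1E x y : y <= x -> exists A : R -> R,
  [/\ A y = 0, forall z, y <= z -> is_derive z 1 A (g z ^+ 2) &
   I1 x y = ((x - y) * A x)%:E].
Proof.
move=> yx; have [A Ay dA] := exists_primitive y cg2.
exists A; split => //; rewrite /I1.
under eq_integral do rewrite kernel1E.
rewrite (@integral_kernel_itv (fun t => g t ^+ 2) (cst (x - y)))//=.
have dH z : y <= z ->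
    is_derive z 1 (fun z => (x - y) * A z) ((x - y) * g z ^+ 2).
  move=> yz; have ? := dA _ yz.
  by apply: is_derive_eq; rewrite /GRing.scale/=; ring.
rewrite (integral_primitive _ dH yx) ?Ay ?mulr0 ?subr0//.
by move=> t; apply: cvgM; [exact: cvg_cst|exact: cg2].
Qed.

Let I1_lt x y : x < y -> I1 x y = 0%E.
Proof.
move=> xy; rewrite /I1; apply: integral0_eq => t _; rewrite kernel1E.
case: ifPn => [/andP[yt tx]|]; rewrite ?mulr0//.
by have := le_lt_trans (le_trans yt tx) xy; rewrite ltxx.
Qed.

Let le_D_I1 x y : ((D x y)%:E <= I1 x y)%E.
Proof.
rewrite /D; case: ifPn => [yx|]; last by rewrite -ltNge => /I1_lt ->.
have [A [Ay dA ->]] := I1E yx; rewrite lee_fin.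
exact: (sqr_increment_le df dA).
Qed.

Let mf : measurable_fun [set: R] f.
Proof. by apply: continuous_measurable_fun; exact: is_derive_continuous df. Qed.

Let mD : measurable_fun [set: R * R] (fun p => D p.1 p.2).
Proof.
apply: measurable_fun_ifT => //=; first exact: measurable_fun_ler.
by apply: measurable_funX; apply: measurable_funB; exact: measurableT_comp.
Qed.

Let mrl k l : measurable_fun [set: R * R * R]
  (fun p => rtail k p.2 p.1.1 * ltail l p.2 p.1.2).
Proof.
apply: measurable_funM.
- have mq : measurable_fun [set: R * R * R] (fun p => (p.2, p.1.1)).
    by apply: measurable_fun_pair => //; exact: measurableT_comp.
  exact: (measurableT_comp (measurable_rtail k) mq).
- have mq : measurable_fun [set: R * R * R] (fun p => (p.2, p.1.2)).
    by apply: measurable_fun_pair => //; exact: measurableT_comp.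
  exact: (measurableT_comp (measurable_ltail l) mq).
Qed.

Let mI (F : R -> R) i j k l : measurable_fun [set: R] F ->
  (forall t, 0 <= F t) ->
  measurable_fun [set: R * R] (fun p => \int[mu]_t (F t *
   (rtail i t p.1 * ltail j t p.2 + rtail k t p.1 * ltail l t p.2))%:E)%E.
Proof.
move=> mF F0.
apply: (@measurable_fun_fubini_tonelli_F _ _ _ _ _ mu (fun p : R * R * R =>
  (F p.2 * (rtail i p.2 p.1.1 * ltail j p.2 p.1.2 +
            rtail k p.2 p.1.1 * ltail l p.2 p.1.2))%:E)).
  apply/measurable_EFinP; apply: measurable_funM.
    exact: measurableT_comp.
  by apply: measurable_funD; exact: mrl.
by move=> p; rewrite lee_fin mulr_ge0// addr_ge0// mulr_ge0 ?rtail_ge0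
  ?ltail_ge0.
Qed.

Let I_ge0 (F : R -> R) i j k l (x y : R) : (forall t, 0 <= F t) ->
  (0 <= \int[mu]_t (F t *
   (rtail i t x * ltail j t y + rtail k t x * ltail l t y))%:E)%E.
Proof.
move=> F0; apply: integral_ge0 => t _.
by rewrite lee_fin mulr_ge0// addr_ge0// mulr_ge0 ?rtail_ge0 ?ltail_ge0.
Qed.

Let D_ge0 x y : 0 <= D x y.
Proof. by rewrite /D; case: ifP => // _; exact: sqr_ge0. Qed.

Let mg2 : measurable_fun [set: R] (fun t => g t ^+ 2).
Proof. exact: continuous_measurable_fun. Qed.

Let g2_ge0 t : 0 <= g t ^+ 2. Proof. exact: sqr_ge0. Qed.

Let mI1 : measurable_fun [set: R * R] (fun p => I1 p.1 p.2).
Proof. exact: mI. Qed.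

Let integral_I1 : (\int[gam \x gam]_p I1 p.1 p.2 = \int[gam]_x (g x ^+ 2)%:E)%E.
Proof.
rewrite fubini_tonelli1//; first by rewrite -integral_kernel1.
by move=> p; apply: I_ge0.
Qed.

(** The full square is [D x y + D y x]: exchanging the variables identifies the two integrals, and
    on the diagonal both terms vanish, so nothing is counted twice. *)
Lemma symmetrize_increment :
  (\int[gam]_x \int[gam]_y ((f x - f y) ^+ 2)%:E =
   2%:E * \int[gam \x gam]_p (D p.1 p.2)%:E)%E.
Proof.
have mDE : measurable_fun [set: R * R] (fun p => (D p.1 p.2)%:E).
  exact/measurable_EFinP.
have mDs : measurable_fun [set: R * R] (fun p => (D p.2 p.1)%:E).
  apply/measurable_EFinP.
  apply: (measurableT_comp mD (g := fun p => (p.2, p.1))).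
  exact: measurable_fun_pair.
transitivity (\int[gam \x gam]_p ((D p.1 p.2)%:E + (D p.2 p.1)%:E))%E.
  have D20 p : (0 <= (D p.1 p.2)%:E + (D p.2 p.1)%:E)%E.
    by rewrite adde_ge0 ?lee_fin.
  rewrite (@fubini_tonelli1 _ _ _ _ _ gam gam _ (emeasurable_funD mDE mDs) D20).
  apply: eq_integral => x _; apply: eq_integral => y _ /=.
  rewrite -EFinD /D; congr EFin; case: ltgtP => [_|_|->].
  - by rewrite addr0.
  - by rewrite add0r -sqrrN opprB.
  - by rewrite subrr expr0n addr0.
rewrite ge0_integralD//; last 2 first.
- by move=> p _; rewrite lee_fin.
- by move=> p _; rewrite lee_fin.
rewrite (_ : 2%:E = 1%:E + 1%:E)%E; last by rewrite -EFinD.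
rewrite ge0_muleDl// !mul1e; congr (_ + _)%E.
have D0 (p : R * R) : (0 <= (D p.1 p.2)%:E)%E by rewrite lee_fin.
have Ds0 (p : R * R) : (0 <= (D p.2 p.1)%:E)%E by rewrite lee_fin.
rewrite (@fubini_tonelli1 _ _ _ _ _ gam gam _ mDE D0).
by rewrite (@fubini_tonelli2 _ _ _ _ _ gam gam _ mDs Ds0).
Qed.

Theorem poincare_normal :
  (\int[gam]_x \int[gam]_y ((f x - f y) ^+ 2)%:E <=
   2%:E * \int[gam]_x (g x ^+ 2)%:E)%E.
Proof.
rewrite symmetrize_increment lee_pmul2l// -integral_I1.
apply: ge0_le_integral => //.
- by move=> p _; rewrite lee_fin.
- exact/measurable_EFinP.
Qed.

Variable h : R -> R.
Hypothesis dg : forall x : R, is_derive x 1 g (h x).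
Hypothesis ch : continuous h.

Let I2 x y := (\int[mu]_t (h t ^+ 2 *
  (rtail 2 t x * ltail 1 t y + rtail 1 t x * ltail 2 t y))%:E)%E.

Let le_I1_D x y : (2%:E * I1 x y <= 2%:E * (D x y)%:E + I2 x y)%E.
Proof.
have I20 : (0 <= I2 x y)%E by apply: I_ge0 => t; exact: sqr_ge0.
rewrite /D; case: ifPn => [yx|]; last first.
  by rewrite -ltNge => /I1_lt ->; rewrite mule0 add0e.
have [A [Ay dA ->]] := I1E yx.
have cM k : continuous (fun t => (t - y) ^+ k * h t ^+ 2).
  move=> t; apply: cvgM.
    apply: (@continuous_expr (fun t => t - y)) => {}t.
    by apply: cvgB; [exact: cvg_id|exact: cvg_cst].
  exact: continuous_expr.
(* Since (x - t) * (t - y) = (x - y) * (t - y) - (t - y)^2, the weight that depends on [x] reduces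
   to two primitives that do not. *)
have [M1 M1y dM1] := exists_primitive y (cM 1%N).
have [M2 M2y dM2] := exists_primitive y (cM 2).
have -> : I2 x y = ((x - y) * ((x - y) * M1 x - M2 x))%:E.
  rewrite /I2; under eq_integral do rewrite kernel2E.
  rewrite (@integral_kernel_itv (fun t => h t ^+ 2)
    (fun t => (x - y) * ((x - y) * (t - y) - (t - y) ^+ 2)))//.
  pose q t := (x - y) *
    ((x - y) * ((t - y) ^+ 1 * h t ^+ 2) - (t - y) ^+ 2 * h t ^+ 2).
  have dH z : y <= z ->
      is_derive z 1 (fun z => (x - y) * ((x - y) * M1 z - M2 z)) (q z).
    move=> yz; have ? := dM1 _ yz; have ? := dM2 _ yz.
    by apply: is_derive_eq; rewrite /q /GRing.scale/=; ring.
  have cq : continuous q.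
    move=> t; apply: cvgM; first exact: cvg_cst.
    apply: cvgB; last exact: cM.
    by apply: cvgM; [exact: cvg_cst|exact: cM].
  transitivity (\int[mu]_(t in `[y, x]) (q t)%:E)%E.
    by apply: eq_integral => t _; congr EFin; rewrite /q; ring.
  by rewrite (integral_primitive cq dH yx) M1y M2y mulr0 subrr mulr0 subr0.
rewrite -EFinM -EFinD lee_fin.
by apply: (sqr_increment_ge df dg dA _ dM2) => // z yz; have := dM1 z yz;
  rewrite expr1.
Qed.

Let mh2 : measurable_fun [set: R] (fun t => h t ^+ 2).
Proof. by apply: measurable_funX; exact: continuous_measurable_fun. Qed.

Let h2_ge0 t : 0 <= h t ^+ 2. Proof. exact: sqr_ge0. Qed.

Theorem second_order_poincare_normal :
  (2%:E * \int[gam]_x (g x ^+ 2)%:E <=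
   \int[gam]_x \int[gam]_y ((f x - f y) ^+ 2)%:E + \int[gam]_x (h x ^+ 2)%:E)%E.
Proof.
have mI2 : measurable_fun [set: R * R] (fun p => I2 p.1 p.2) by exact: mI.
have I20 x y : (0 <= I2 x y)%E by apply: I_ge0.
have I10 x y : (0 <= I1 x y)%E by apply: I_ge0.
have -> : (\int[gam]_x (h x ^+ 2)%:E = \int[gam \x gam]_p I2 p.1 p.2)%E.
  by rewrite fubini_tonelli1//; rewrite -integral_kernel2.
have mDE : measurable_fun [set: R * R] (fun p => (D p.1 p.2)%:E).
  exact/measurable_EFinP.
have ZE (u : R * R -> \bar R) : measurable_fun [set: R * R] u ->
    (forall p, 0 <= u p)%E ->
    (2%:E * \int[gam \x gam]_p u p = \int[gam \x gam]_p (2%:E * u p))%E.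
  by move=> mu0 u0; rewrite ge0_integralZl// lee_fin.
rewrite symmetrize_increment -integral_I1 !ZE//; last first.
  by move=> p; rewrite lee_fin.
rewrite -ge0_integralD//.
- apply: ge0_le_integral => //.
  + by move=> p _; rewrite mule_ge0.
  + exact: measurable_funeM.
  + by apply: emeasurable_funD => //; exact: measurable_funeM.
- by move=> p _; rewrite mule_ge0 ?lee_fin.
- exact: measurable_funeM.
Qed.

End one_dim_ineq.

(** * Gaussian integrals on row vectors *)

Section rV_borel.
Context {R : realType} (n : nat).

Let box (l u : 'rV[rat]_n) : set 'rV[R]_n :=
  \bigcap_(i in [set: 'I_n]) [set x | ratr (l ord0 i) < x ord0 i < ratr
    (u ord0 i)].

Let measurable_box l u : measurable (box l u).
Proof.
apply: fin_bigcap_measurable; first exact: finite_finset.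
move=> i _.
have := @measurable_rV_coor R n i measurableT
  `]ratr (l ord0 i), ratr (u ord0 i)[%classic (measurable_itv _).
rewrite setTI; congr measurable; apply/seteqP; split => x /=; rewrite in_itv/=;
  exact.
Qed.

(** The sigma-algebra is generated by coordinates while the topology comes from the sup norm, whose
    balls are boxes. An open set is therefore the union of the boxes with rational corners that it
    contains, a countable family. *)
Lemma open_measurable_rV (U : set 'rV[R]_n) : open U -> measurable U.
Proof.
move=> oU.
pose F (p : 'rV[rat]_n * 'rV[rat]_n) :=
  if `[< box p.1 p.2 `<=` U >] then box p.1 p.2 else set0.
rewrite (_ : U = \bigcup_p F p).
  apply: countable_bigcupT_measurable => // p; rewrite /F.
  by case: ifP.
apply/seteqP; split => [x Ux|x [p _]]; last first.
  by rewrite /F; case: ifPn => // /asboolP; exact.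
move: oU; rewrite openE => /(_ _ Ux) /nbhs_ballP[e /= e0 eU].
have /boolp.choice[l lP] : forall i : 'I_n, exists q : rat,
    ratr q \in `]x ord0 i - e, x ord0 i[%R.
  by move=> i; apply: rat_in_itvoo; rewrite ltrBlDr ltrDl.
have /boolp.choice[u uP] : forall i : 'I_n, exists q : rat,
    ratr q \in `]x ord0 i, x ord0 i + e[%R.
  by move=> i; apply: rat_in_itvoo; rewrite ltrDl.
exists (\row_i l i, \row_i u i) => //; rewrite /F ifT.
  move=> i _ /=; rewrite !mxE; have := lP i; have := uP i.
  by rewrite !in_itv/= => /andP[-> _] /andP[_ ->].
apply/asboolP => z xz; apply: eU; split => // i j; rewrite (ord1 i).
have /= := xz j Logic.I; rewrite !mxE => /andP[lz zu].
have := lP j; have := uP j; rewrite !in_itv/= => /andP[_ ux] /andP[xl _].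
rewrite /ball/= ltr_distlC; apply/andP; split.
- exact: lt_trans xl lz.
- exact: lt_trans zu ux.
Qed.

Lemma continuous_measurable_rV (f : 'rV[R]_n -> R) :
  continuous f -> measurable_fun [set: 'rV[R]_n] f.
Proof.
move=> /continuousP cf; apply: (measurability _ (RGenOpens.measurableE R)).
move=> _ [_ [a [b ->] <-]]; rewrite setTI; apply: open_measurable_rV.
exact/cf/interval_open.
Qed.

End rV_borel.

Section gauss_cons.
Context {R : realType} (n : nat).
Notation gam := (@normal_prob R 0 1).

Lemma ge0_integral_gauss m (F : 'rV[R]_m -> \bar R) :
  measurable_fun [set: 'rV[R]_m] F -> (forall x, 0 <= F x)%E ->
  (\int[gauss m]_x F x = \int[lebesgue_rV m]_x (F x * (gauss_density x)%:E))%E.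
Proof.
move=> mF F0.
apply: (@ge0_integral_density _ _ _ (lebesgue_rV m) (gauss m)
  (@gauss_density R m)) => //.
- exact: measurable_gauss_density.
- exact: gauss_density_ge0.
Qed.

(** The splitting behind the inductions on dimension: Lebesgue measure is a pushforward along
    [rV_cons], and the density factors by [gauss_density_cons]. *)
Lemma integral_gauss_cons (F : 'rV[R]_n.+1 -> \bar R) :
  measurable_fun [set: 'rV[R]_n.+1] F -> (forall x, 0 <= F x)%E ->
  (\int[gauss n.+1]_x F x =
   \int[gam]_a \int[gauss n]_y F (rV_cons (a, y)))%E.
Proof.
move=> mF F0.
have mFc : measurable_fun [set: R * 'rV[R]_n] (fun p => F (rV_cons p)).
  exact: (measurableT_comp mF (@measurable_rV_cons R n)).
have mG : measurable_fun [set: R]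
  (fun a => \int[gauss n]_y F (rV_cons (a, y)))%E.
  exact: (@measurable_fun_fubini_tonelli_F _ _ _ _ _ (gauss n)
    (fun p => F (rV_cons p))).
have mgd k : measurable_fun [set: 'rV[R]_k] (fun x => (gauss_density x)%:E).
  by apply/measurable_EFinP; exact: measurable_gauss_density.
rewrite ge0_integral_gauss//.
rewrite ge0_integral_pushforward//=; first last.
- by move=> x _; rewrite mule_ge0// lee_fin gauss_density_ge0.
- exact: (emeasurable_funM mF (mgd _)).
- exact: measurable_rV_cons.
rewrite preimage_setT ge0_integral_normal//; last first.
  by move=> a; exact: integral_ge0.
rewrite fubini_tonelli1//=; first last.
- by move=> p; rewrite mule_ge0// lee_fin gauss_density_ge0.
- apply: emeasurable_funM; first exact: mFc.
  exact: (measurableT_comp (mgd _) (@measurable_rV_cons R n)).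
apply: eq_integral => a _; rewrite /fubini_F/=.
have mFa : measurable_fun [set: 'rV[R]_n] (fun y => F (rV_cons (a, y))).
  exact: (measurableT_comp mFc (measurable_pair1 a)).
rewrite ge0_integral_gauss// -ge0_integralZr//.
- apply: eq_integral => y _.
  by rewrite gauss_density_cons EFinM -muleA; congr (_ * _)%E; rewrite muleC.
- exact: (emeasurable_funM mFa (mgd _)).
- by move=> y _; rewrite mule_ge0// lee_fin gauss_density_ge0.
- by rewrite lee_fin normal_pdf_ge0.
Qed.

End gauss_cons.

Section sections.
Context {R : realType} (n : nat).
Implicit Types (f : 'rV[R]_n.+1 -> R) (a : R) (y : 'rV[R]_n).

Lemma rV_cons_shiftl a y (h : R) :
  rV_cons (h *: (1 : R) + a, y) = h *: delta_mx ord0 ord0 + rV_cons (a, y).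
Proof.
apply/rowP => i; rewrite /rV_cons !mxE ?eqxx /=.
case: unliftP => [j ->|->]/=.
  by rewrite /GRing.scale/= mulr0 add0r.
by rewrite /GRing.scale/= ?eqxx ?mulr1.
Qed.

Lemma rV_cons_shiftr a y (h : R) j :
  rV_cons (a, h *: delta_mx ord0 j + y) =
  h *: delta_mx ord0 (lift ord0 j) + rV_cons (a, y).
Proof.
apply/rowP => i; rewrite /rV_cons !mxE ?eqxx /=.
case: unliftP => [k ->|->]/=.
  by rewrite !mxE eqxx/= (inj_eq lift_inj).
by rewrite mulr0 add0r.
Qed.

Lemma continuous_rV_consr a : continuous (fun y => rV_cons (a, y)).
Proof.
move=> y A /nbhs_ballP[e /= e0 eA].
apply/nbhs_ballP; exists e => //= z [_ yz]; apply: eA; split => // i j.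
rewrite /rV_cons !mxE; case: unliftP => [k _|_]/=; last exact: ballxx.
exact: yz.
Qed.

Lemma continuous_rV_consl y : continuous (fun a : R => rV_cons (a, y)).
Proof.
move=> a A /nbhs_ballP[e /= e0 eA].
apply/nbhs_ballP; exists e => //= z az; apply: eA; split => // i j.
rewrite /rV_cons !mxE; case: unliftP => [k _|_]//=; exact: ballxx.
Qed.

Lemma is_derive_rV_consl f a y :
  (forall x, derivable f x (delta_mx ord0 ord0)) ->
  is_derive a 1 (fun a => f (rV_cons (a, y))) (partial ord0 f (rV_cons (a, y))).
Proof.
move=> /(_ (rV_cons (a, y))) df.
have E : (fun h : R => h^-1 *: (((fun a : R => f (rV_cons (a, y))) \o shift a)
      (h *: (1 : R)) - f (rV_cons (a, y)))) =
    (fun h : R => h^-1 *: ((f \o shift (rV_cons (a, y)))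
      (h *: delta_mx ord0 ord0) - f (rV_cons (a, y)))).
  by apply/funext => h /=; rewrite rV_cons_shiftl.
by split; [rewrite /derivable E|rewrite /partial /derive E].
Qed.

Lemma derivable_rV_consr f a y j :
  derivable f (rV_cons (a, y)) (delta_mx ord0 (lift ord0 j)) ->
  derivable (fun y => f (rV_cons (a, y))) y (delta_mx ord0 j).
Proof.
rewrite /derivable; set F := fun h => _; set G := fun h => _.
suff -> : F = G by [].
by apply/funext => h; rewrite /F /G/= rV_cons_shiftr.
Qed.

Lemma partial_rV_consr f a j :
  partial j (fun y => f (rV_cons (a, y))) =
  fun y => partial (lift ord0 j) f (rV_cons (a, y)).
Proof.
apply/funext => y; rewrite /partial /derive.
set F := fun h => _; set G := fun h => _; suff -> : F = G by [].
by apply/funext => h; rewrite /F /G/= rV_cons_shiftr.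
Qed.

Lemma Ck_rV_consr k f a : Ck k f -> Ck k (fun y => f (rV_cons (a, y))).
Proof.
elim: k f => [|k IH] f /=.
  move=> cf y; exact: (continuous_comp (@continuous_rV_consr a y) (cf _)).
move=> [cf df]; split.
  move=> y; exact: (continuous_comp (@continuous_rV_consr a y) (cf _)).
move=> i; have [dfi Cfi] := df (lift ord0 i); split.
  by move=> y; exact: derivable_rV_consr.
by rewrite partial_rV_consr; exact: IH.
Qed.

End sections.

Lemma Ck_continuous {R : realType} n k (f : 'rV[R]_n -> R) : Ck k f ->
  continuous f.
Proof. by case: k => [//|k []]. Qed.

(** * Tensorization of squared increments *)

Section square.
Context d (T : measurableType d) (R : realType) (P : probability T R).
Local Open Scope ereal_scope.

Lemma prob_integral_cst (c : \bar R) : \int[P]_x c = c.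
Proof.
rewrite integral_cst//= -[RHS]mule1; congr (_ * _); exact: probability_setT.
Qed.

Lemma integral_prod_fst (h : T -> \bar R) : measurable_fun [set: T] h ->
  (forall x, 0 <= h x) -> \int[P \x P]_p h p.1 = \int[P]_x h x.
Proof.
move=> mh h0; rewrite fubini_tonelli1//; last exact: measurableT_comp.
apply: eq_integral => x _; rewrite /fubini_F/=; exact: prob_integral_cst.
Qed.

Lemma integral_prod_swap (k : T * T -> \bar R) :
  measurable_fun [set: T * T] k ->
  (forall p, 0 <= k p) -> \int[P \x P]_p k (p.2, p.1) = \int[P \x P]_p k p.
Proof.
move=> mk k0; rewrite fubini_tonelli1//; last first.
  by apply: (measurableT_comp mk); exact: measurable_fun_pair.
by rewrite fubini_tonelli2.
Qed.

Lemma integral_prod_snd (h : T -> \bar R) : measurable_fun [set: T] h ->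
  (forall x, 0 <= h x) -> \int[P \x P]_p h p.2 = \int[P]_x h x.
Proof.
move=> mh h0; rewrite -(integral_prod_swap (k := fun p => h p.2))//=.
  exact: integral_prod_fst.
exact: measurableT_comp.
Qed.

(* Twice the variance. *)
Definition sqincr (f : T -> R) : \bar R :=
  \int[P]_x \int[P]_y ((f x - f y) ^+ 2)%:E.

Lemma sqincr_ge0 (f : T -> R) : 0 <= sqincr f.
Proof.
by apply: integral_ge0 => x _; apply: integral_ge0 => y _;
  rewrite lee_fin sqr_ge0.
Qed.

End square.

Section tensor.
Context d1 (X : measurableType d1) d2 (Y : measurableType d2) (R : realType).
Variables (P : probability X R) (Q : probability Y R) (f : X * Y -> R).
Hypothesis mf : measurable_fun [set: X * Y] f.
Local Open Scope ereal_scope.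
Let PP : probability (X * X)%type R := P \x P.
Let QQ : probability (Y * Y)%type R := Q \x Q.
Let PQ := PP \x QQ.
Let Z : Type := ((X * X) * (Y * Y))%type.

Let sq (a b : Z -> X * Y) (p : Z) : \bar R := ((f (a p) - f (b p)) ^+ 2)%:E.
Let c11 (p : Z) := (p.1.1, p.2.1).
Let c12 (p : Z) := (p.1.1, p.2.2).
Let c21 (p : Z) := (p.1.2, p.2.1).
Let c22 (p : Z) := (p.1.2, p.2.2).

Let mfc11 : measurable_fun [set: (X * X) * (Y * Y)] (f \o c11).
Proof.
by apply: measurableT_comp => //; apply: measurable_fun_pair;
  exact: measurableT_comp.
Qed.
Let mfc12 : measurable_fun [set: (X * X) * (Y * Y)] (f \o c12).
Proof.
by apply: measurableT_comp => //; apply: measurable_fun_pair;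
  exact: measurableT_comp.
Qed.
Let mfc21 : measurable_fun [set: (X * X) * (Y * Y)] (f \o c21).
Proof.
by apply: measurableT_comp => //; apply: measurable_fun_pair;
  exact: measurableT_comp.
Qed.
Let mfc22 : measurable_fun [set: (X * X) * (Y * Y)] (f \o c22).
Proof.
by apply: measurableT_comp => //; apply: measurable_fun_pair;
  exact: measurableT_comp.
Qed.

Let sq_ge0 a b p : 0 <= sq a b p.
Proof. by rewrite lee_fin sqr_ge0. Qed.

Let msq a b : measurable_fun [set: (X * X) * (Y * Y)] (f \o a) ->
  measurable_fun [set: (X * X) * (Y * Y)] (f \o b) ->
  measurable_fun [set: (X * X) * (Y * Y)] (sq a b).
Proof.
move=> ma mb; apply/measurable_EFinP; apply: measurable_funX.
exact: measurable_funB.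
Qed.

Definition mixed_incr (p : (X * X) * (Y * Y)) : R :=
  (f (p.1.1, p.2.1) - f (p.1.2, p.2.1)) - (f (p.1.1, p.2.2) - f (p.1.2, p.2.2)).

Lemma measurable_mixed_incr :
  measurable_fun [set: (X * X) * (Y * Y)] mixed_incr.
Proof. by apply: measurable_funB; exact: measurable_funB. Qed.

Let mfx y : measurable_fun [set: X] (fun x => f (x, y)).
Proof. exact: (measurableT_comp mf (measurable_pair2 y)). Qed.

Let mfy x : measurable_fun [set: Y] (fun y => f (x, y)).
Proof. exact: (measurableT_comp mf (measurable_pair1 x)). Qed.

Lemma measurable_sqincr_left : measurable_fun [set: Y]
  (fun y => sqincr P (fun x => f (x, y))).
Proof.
rewrite (_ : (fun y => _) = fubini_G PP
  (fun q : (X * X) * Y => ((f (q.1.1, q.2) - f (q.1.2, q.2)) ^+ 2)%:E));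
  last first.
  apply/funext => y; rewrite /fubini_G fubini_tonelli1//=; last first.
    by move=> p; rewrite lee_fin sqr_ge0.
  apply/measurable_EFinP; apply: measurable_funX; apply: measurable_funB;
  exact: (measurableT_comp (mfx y)).
apply: (@measurable_fun_fubini_tonelli_G _ _ _ _ _ PP
  (fun q : (X * X) * Y => ((f (q.1.1, q.2) - f (q.1.2, q.2)) ^+ 2)%:E)).
  apply/measurable_EFinP; apply: measurable_funX; apply: measurable_funB;
   apply: (measurableT_comp mf); apply: measurable_fun_pair => //;
     exact: measurableT_comp.
by move=> p; rewrite lee_fin sqr_ge0.
Qed.

Lemma measurable_sqincr_right :
  measurable_fun [set: X] (fun x => sqincr Q (fun y => f (x, y))).
Proof.
rewrite (_ : (fun x => _) = fubini_F QQ
  (fun q : X * (Y * Y) => ((f (q.1, q.2.1) - f (q.1, q.2.2)) ^+ 2)%:E));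
  last first.
  apply/funext => x; rewrite /fubini_F fubini_tonelli1//=; last first.
    by move=> p; rewrite lee_fin sqr_ge0.
  apply/measurable_EFinP; apply: measurable_funX; apply: measurable_funB;
  exact: (measurableT_comp (mfy x)).
apply: (@measurable_fun_fubini_tonelli_F _ _ _ _ _ QQ
  (fun q : X * (Y * Y) => ((f (q.1, q.2.1) - f (q.1, q.2.2)) ^+ 2)%:E)).
  apply/measurable_EFinP; apply: measurable_funX; apply: measurable_funB;
   apply: (measurableT_comp mf); apply: measurable_fun_pair => //;
     exact: measurableT_comp.
by move=> p; rewrite lee_fin sqr_ge0.
Qed.

Let inner_left y : \int[PP]_u ((f (u.1, y) - f (u.2, y)) ^+ 2)%:E =
  sqincr P (fun x => f (x, y)).
Proof.
rewrite fubini_tonelli1//=; last by move=> p; rewrite lee_fin sqr_ge0.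
apply/measurable_EFinP; apply: measurable_funX; apply: measurable_funB;
exact: (measurableT_comp (mfx y)).
Qed.

Let inner_right x : \int[QQ]_v ((f (x, v.1) - f (x, v.2)) ^+ 2)%:E =
  sqincr Q (fun y => f (x, y)).
Proof.
rewrite fubini_tonelli1//=; last by move=> p; rewrite lee_fin sqr_ge0.
apply/measurable_EFinP; apply: measurable_funX; apply: measurable_funB;
exact: (measurableT_comp (mfy x)).
Qed.

Let T1 : \int[PQ]_p sq c11 c21 p = \int[Q]_y sqincr P (fun x => f (x, y)).
Proof.
rewrite fubini_tonelli2//; last exact: msq.
rewrite -(integral_prod_fst _ measurable_sqincr_left (fun=> sqincr_ge0 _ _)).
by apply: eq_integral => v _; exact: inner_left.
Qed.

Let T1' : \int[PQ]_p sq c12 c22 p = \int[Q]_y sqincr P (fun x => f (x, y)).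
Proof.
rewrite fubini_tonelli2//; last exact: msq.
rewrite -(integral_prod_snd _ measurable_sqincr_left (fun=> sqincr_ge0 _ _)).
by apply: eq_integral => v _; exact: inner_left.
Qed.

Let T2 : \int[PQ]_p sq c11 c12 p = \int[P]_x sqincr Q (fun y => f (x, y)).
Proof.
rewrite fubini_tonelli1//; last exact: msq.
rewrite -(integral_prod_fst _ measurable_sqincr_right (fun=> sqincr_ge0 _ _)).
by apply: eq_integral => v _; exact: inner_right.
Qed.

Let T2' : \int[PQ]_p sq c21 c22 p = \int[P]_x sqincr Q (fun y => f (x, y)).
Proof.
rewrite fubini_tonelli1//; last exact: msq.
rewrite -(integral_prod_snd _ measurable_sqincr_right (fun=> sqincr_ge0 _ _)).
by apply: eq_integral => v _; exact: inner_right.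
Qed.

(** [PQ] groups the variables as (x, x') and (y, y'), whereas an increment over the product space
    groups them as (x, y) and (x', y'); exchanging [y] with [x'] passes from one to the other. *)
Let iter4 (K : Z -> \bar R) : measurable_fun [set: (X * X) * (Y * Y)] K ->
  (forall p, 0 <= K p) ->
  \int[PQ]_p K p = \int[P]_x \int[Q]_y \int[P]_x' \int[Q]_y' K
    ((x, x'), (y, y')).
Proof.
move=> mK K0; rewrite (@fubini_tonelli1 _ _ _ _ _ PP QQ K mK K0).
rewrite (@fubini_tonelli1 _ _ _ _ _ P P (fubini_F QQ K)); last 2 first.
- exact: (@measurable_fun_fubini_tonelli_F _ _ _ _ _ QQ K mK K0).
- by move=> u; exact: integral_ge0.
apply: eq_integral => x _; rewrite /fubini_F/=.
have mKx x' : measurable_fun [set: Y * Y] (fun v => K ((x, x'), v)).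
  exact: (measurableT_comp mK (measurable_pair1 (x, x'))).
pose c (q : X * Y) := \int[Q]_y' K ((x, q.1), (q.2, y')).
have mc : measurable_fun [set: X * Y] c.
  apply: (@measurable_fun_fubini_tonelli_F _ _ _ _ _ Q
    (fun q : (X * Y) * Y => K ((x, q.1.1), (q.1.2, q.2)))) => //.
  apply: (measurableT_comp mK); apply: measurable_fun_pair.
    by apply: measurable_fun_pair => //; exact: measurableT_comp.
  by apply: measurable_fun_pair => //; exact: measurableT_comp.
have c0 q : 0 <= c q by exact: integral_ge0.
transitivity (\int[P]_x' \int[Q]_y c (x', y)).
  apply: eq_integral => x' _.
  exact: (@fubini_tonelli1 _ _ _ _ _ Q Q _ (mKx x') (fun v => K0 ((x, x'), v))).
exact: (@fubini_tonelli _ _ _ _ _ P Q c mc c0).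
Qed.

(** Twice the variance of [f] under the product law, in the iterated form that [sqincr_gauss_cons]
    produces. *)
Let W := \int[P]_x \int[Q]_y \int[P]_x' \int[Q]_y'
  ((f (x, y) - f (x', y')) ^+ 2)%:E.

Let T3 : \int[PQ]_p sq c11 c22 p = W.
Proof. exact: (iter4 (msq mfc11 mfc22) (sq_ge0 c11 c22)). Qed.

Let T3' : \int[PQ]_p sq c21 c12 p = W.
Proof.
have m1 := msq mfc11 mfc22; have m2 := msq mfc21 mfc12.
rewrite -T3 (@fubini_tonelli1 _ _ _ _ _ PP QQ _ m2 (sq_ge0 _ _)).
rewrite (@fubini_tonelli1 _ _ _ _ _ PP QQ _ m1 (sq_ge0 _ _)).
pose h := fubini_F QQ (sq c11 c22).
rewrite -[RHS](@integral_prod_swap _ _ _ P h).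
- by [].
- exact: (@measurable_fun_fubini_tonelli_F _ _ _ _ _ QQ _ m1 (sq_ge0 _ _)).
- by move=> p; exact: integral_ge0.
Qed.

(* With p, q, r, s the values of f at (x, y), (x', y), (x, y'), (x', y'):
   (p - q)^2 + (r - s)^2 + (p - r)^2 + (q - s)^2
   = (p - s)^2 + (q - r)^2 + (p - q - r + s)^2. *)
Theorem tensor_sqincr :
  2%:E * \int[Q]_y sqincr P (fun x => f (x, y)) +
  2%:E * \int[P]_x sqincr Q (fun y => f (x, y)) =
  2%:E * W + \int[PQ]_p (mixed_incr p ^+ 2)%:E.
Proof.
have two (z : \bar R) : 0 <= z -> 2%:E * z = z + z.
  move=> z0; rewrite (_ : 2%:E = 1%:E + 1%:E); last by rewrite -EFinD.
  by rewrite ge0_muleDl// !mul1e.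
have W0 : 0 <= W.
  by do 4 (apply: integral_ge0 => ? _); rewrite lee_fin sqr_ge0.
have A0 : 0 <= \int[Q]_y sqincr P (fun x => f (x, y)).
  by apply: integral_ge0 => y _; exact: sqincr_ge0.
have B0 : 0 <= \int[P]_x sqincr Q (fun y => f (x, y)).
  by apply: integral_ge0 => x _; exact: sqincr_ge0.
rewrite [X in X + _ = _](two _ A0) [X in _ + X = _](two _ B0)
  [X in _ = X + _](two _ W0).
(* Each doubled term is read as two integrals over the rectangle of four points: the two parallel
   sides in each direction, and the two diagonals. *)
rewrite -{1}T1 -T1' -{1}T2 -T2' -{1}T3 -T3'.
have mm : measurable_fun [set: (X * X) * (Y * Y)]
  (fun p => (mixed_incr p ^+ 2)%:E).
  by apply/measurable_EFinP; apply: measurable_funX;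
    exact: measurable_mixed_incr.
have m0 p : 0 <= (mixed_incr p ^+ 2)%:E by rewrite lee_fin sqr_ge0.
have add (u v : Z -> \bar R) : measurable_fun [set: (X * X) * (Y * Y)] u ->
    measurable_fun [set: (X * X) * (Y * Y)] v ->
    (forall p, 0 <= u p) -> (forall p, 0 <= v p) ->
    \int[PQ]_p u p + \int[PQ]_p v p = \int[PQ]_p (u \+ v) p.
  by move=> mu mv u0 v0; rewrite ge0_integralD.
have m1 := msq mfc11 mfc21. have m1' := msq mfc12 mfc22.
have m2 := msq mfc11 mfc12. have m2' := msq mfc21 mfc22.
have m3 := msq mfc11 mfc22. have m3' := msq mfc21 mfc12.
have D0 a b a' b' p : 0 <= (sq a b \+ sq a' b') p by exact: adde_ge0.
rewrite (add _ _ m1 m1' (sq_ge0 _ _) (sq_ge0 _ _)).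
rewrite (add _ _ m2 m2' (sq_ge0 _ _) (sq_ge0 _ _)).
rewrite (add _ _ m3 m3' (sq_ge0 _ _) (sq_ge0 _ _)).
rewrite (add _ _ (emeasurable_funD m1 m1') (emeasurable_funD m2 m2')
  (D0 _ _ _ _) (D0 _ _ _ _)).
rewrite (add _ _ (emeasurable_funD m3 m3') mm (D0 _ _ _ _) m0).
apply: eq_integral => p _; rewrite /= /sq /mixed_incr /c11 /c12 /c21 /c22
  -!EFinD.
congr EFin; ring.
Qed.

Let mmix2 : measurable_fun [set: (X * X) * (Y * Y)]
  (fun p => (mixed_incr p ^+ 2)%:E).
Proof.
by apply/measurable_EFinP; apply: measurable_funX; exact: measurable_mixed_incr.
Qed.

Let mix2_ge0 p : 0 <= (mixed_incr p ^+ 2)%:E.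
Proof. by rewrite lee_fin sqr_ge0. Qed.

(** The Efron-Stein inequality: drop the mixed square from [tensor_sqincr]. *)
Lemma tensor_sqincr_le :
  W <= \int[Q]_y sqincr P (fun x => f (x, y)) +
       \int[P]_x sqincr Q (fun y => f (x, y)).
Proof.
have A0 : 0 <= \int[Q]_y sqincr P (fun x => f (x, y)).
  by apply: integral_ge0 => y _; exact: sqincr_ge0.
have B0 : 0 <= \int[P]_x sqincr Q (fun y => f (x, y)).
  by apply: integral_ge0 => x _; exact: sqincr_ge0.
rewrite -(@lee_pmul2l _ 2%:E)//.
rewrite (ge0_muleDr _ A0 B0) tensor_sqincr leeDl//; exact: integral_ge0.
Qed.

(** Seen as a function of [x], the mixed increment is an ordinary increment of
    [f (x, y) - f (x, y')], to which a Poincaré inequality in [x] applies. *)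
Lemma mixed_left : \int[PQ]_p (mixed_incr p ^+ 2)%:E =
  \int[QQ]_v sqincr P (fun x => f (x, v.1) - f (x, v.2))%R.
Proof.
rewrite (@fubini_tonelli2 _ _ _ _ _ PP QQ _ mmix2 mix2_ge0).
apply: eq_integral => v _; rewrite /fubini_G.
rewrite (@fubini_tonelli1 _ _ _ _ _ P P (fun u => (mixed_incr (u, v) ^+ 2)%:E)).
- apply: eq_integral => x _; apply: eq_integral => x' _.
  by congr EFin; rewrite /mixed_incr/=; ring.
- exact: (measurableT_comp mmix2 (measurable_pair2 v)).
- by move=> u; exact: mix2_ge0.
Qed.

Lemma mixed_right : \int[PQ]_p (mixed_incr p ^+ 2)%:E =
  \int[PP]_u sqincr Q (fun y => f (u.1, y) - f (u.2, y))%R.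
Proof.
rewrite (@fubini_tonelli1 _ _ _ _ _ PP QQ _ mmix2 mix2_ge0).
apply: eq_integral => u _; rewrite /fubini_F.
rewrite (@fubini_tonelli1 _ _ _ _ _ Q Q (fun v => (mixed_incr (u, v) ^+ 2)%:E)).
- by [].
- exact: (measurableT_comp mmix2 (measurable_pair1 u)).
- by move=> v; exact: mix2_ge0.
Qed.

Lemma mleft : measurable_fun [set: Y * Y]
  (fun v => sqincr P (fun x => f (x, v.1) - f (x, v.2))%R).
Proof.
rewrite (_ : (fun v => _) = fubini_G PP (fun p => (mixed_incr p ^+ 2)%:E)).
  exact: (@measurable_fun_fubini_tonelli_G _ _ _ _ _ PP _ mmix2 mix2_ge0).
apply/funext => v; rewrite /fubini_G.
rewrite (@fubini_tonelli1 _ _ _ _ _ P P (fun u => (mixed_incr (u, v) ^+ 2)%:E)).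
- apply: eq_integral => x _; apply: eq_integral => x' _.
  by congr EFin; rewrite /mixed_incr/=; ring.
- exact: (measurableT_comp mmix2 (measurable_pair2 v)).
- by move=> u; exact: mix2_ge0.
Qed.

Lemma mright : measurable_fun [set: X * X]
  (fun u => sqincr Q (fun y => f (u.1, y) - f (u.2, y))%R).
Proof.
rewrite (_ : (fun v => _) = fubini_F QQ (fun p => (mixed_incr p ^+ 2)%:E)).
  exact: (@measurable_fun_fubini_tonelli_F _ _ _ _ _ QQ _ mmix2 mix2_ge0).
apply/funext => u; rewrite /fubini_F.
rewrite (@fubini_tonelli1 _ _ _ _ _ Q Q (fun v => (mixed_incr (u, v) ^+ 2)%:E)).
- by [].
- exact: (measurableT_comp mmix2 (measurable_pair1 u)).
- by move=> v; exact: mix2_ge0.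
Qed.

End tensor.

Section mixed_bounds.
Context d1 (X : measurableType d1) d2 (Y : measurableType d2) (R : realType).
Variables (P : probability X R) (Q : probability Y R).
Local Open Scope ereal_scope.
Let PP : probability (X * X)%type R := P \x P.
Let QQ : probability (Y * Y)%type R := Q \x Q.

Section exchange.
Variable k : X * Y -> R.
Hypothesis mk : measurable_fun [set: X * Y] k.

Let mkl : measurable_fun [set: X * (Y * Y)]
  (fun q => ((k (q.1, q.2.1) - k (q.1, q.2.2)) ^+ 2)%:E).
Proof.
apply/measurable_EFinP; apply: measurable_funX; apply: measurable_funB;
  apply: (measurableT_comp mk); apply: measurable_fun_pair => //;
  exact: measurableT_comp.
Qed.

Let mkr : measurable_fun [set: (X * X) * Y]
  (fun q => ((k (q.1.1, q.2) - k (q.1.2, q.2)) ^+ 2)%:E).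
Proof.
apply/measurable_EFinP; apply: measurable_funX; apply: measurable_funB;
  apply: (measurableT_comp mk); apply: measurable_fun_pair => //;
  exact: measurableT_comp.
Qed.

Let kl0 (q : X * (Y * Y)) : 0 <= ((k (q.1, q.2.1) - k (q.1, q.2.2)) ^+ 2)%:E.
Proof. by rewrite lee_fin sqr_ge0. Qed.

Let kr0 (q : (X * X) * Y) : 0 <= ((k (q.1.1, q.2) - k (q.1.2, q.2)) ^+ 2)%:E.
Proof. by rewrite lee_fin sqr_ge0. Qed.

Lemma measurable_sqdiff_right : measurable_fun [set: Y * Y]
  (fun v => \int[P]_x ((k (x, v.1) - k (x, v.2)) ^+ 2)%:E).
Proof. exact: (@measurable_fun_fubini_tonelli_G _ _ _ _ _ P _ mkl kl0). Qed.

Lemma measurable_sqdiff_left : measurable_fun [set: X * X]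
  (fun u => \int[Q]_y ((k (u.1, y) - k (u.2, y)) ^+ 2)%:E).
Proof. exact: (@measurable_fun_fubini_tonelli_F _ _ _ _ _ Q _ mkr kr0). Qed.

Lemma integral_sqdiff_right :
  \int[QQ]_v \int[P]_x ((k (x, v.1) - k (x, v.2)) ^+ 2)%:E =
  \int[P]_x sqincr Q (fun y => k (x, y)).
Proof.
rewrite -(@fubini_tonelli _ _ _ _ _ P QQ _ mkl kl0).
apply: eq_integral => x _.
rewrite (@fubini_tonelli1 _ _ _ _ _ Q Q
  (fun v => ((k (x, v.1) - k (x, v.2)) ^+ 2)%:E)).
- by [].
- exact: (measurableT_comp mkl (measurable_pair1 x)).
- by move=> v; exact: (kl0 (x, v)).
Qed.

Lemma integral_sqdiff_left :
  \int[PP]_u \int[Q]_y ((k (u.1, y) - k (u.2, y)) ^+ 2)%:E =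
  \int[Q]_y sqincr P (fun x => k (x, y)).
Proof.
rewrite (@fubini_tonelli _ _ _ _ _ PP Q _ mkr kr0).
apply: eq_integral => y _.
rewrite (@fubini_tonelli1 _ _ _ _ _ P P
  (fun u => ((k (u.1, y) - k (u.2, y)) ^+ 2)%:E)).
- by [].
- exact: (measurableT_comp mkr (measurable_pair2 y)).
- by move=> u; exact: (kr0 (u, y)).
Qed.
End exchange.

Variable f : X * Y -> R.
Hypothesis mf : measurable_fun [set: X * Y] f.

Let W := \int[P]_x \int[Q]_y \int[P]_x' \int[Q]_y'
  ((f (x, y) - f (x', y')) ^+ 2)%:E.
Let A := \int[Q]_y sqincr P (fun x => f (x, y)).
Let B := \int[P]_x sqincr Q (fun y => f (x, y)).

(** Here [k] is meant to be the derivative of [f] in [x]. Poincaré in [x] at fixed y and y' leaves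
    the increment of [k] between them, and averaging over y and y' gives its [sqincr] in [y]. *)
Lemma tensor_le_right (k : X * Y -> R) : measurable_fun [set: X * Y] k ->
  (forall y y', sqincr P (fun x => f (x, y) - f (x, y'))%R <=
     2%:E * \int[P]_x ((k (x, y) - k (x, y')) ^+ 2)%:E) ->
  2%:E * A + 2%:E * B <= 2%:E * W + 2%:E * \int[P]_x sqincr Q
    (fun y => k (x, y)).
Proof.
move=> mk fk; rewrite tensor_sqincr// leeD2l// mixed_left//.
rewrite -integral_sqdiff_right//; apply: ge0_le_integralZl => //.
- exact: mleft.
- by move=> v; exact: sqincr_ge0.
- exact: measurable_sqdiff_right.
- by move=> v; apply: integral_ge0 => x _; rewrite lee_fin sqr_ge0.
Qed.

(** The mirror image, where [y] has several coordinates and the [k i] are the partial derivatives in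
    them. *)
Lemma tensor_le_left (I : finType) (k : I -> X * Y -> R) :
  (forall i, measurable_fun [set: X * Y] (k i)) ->
  (forall x x', sqincr Q (fun y => f (x, y) - f (x', y))%R <=
     2%:E * \sum_i \int[Q]_y ((k i (x, y) - k i (x', y)) ^+ 2)%:E) ->
  2%:E * A + 2%:E * B <=
  2%:E * W + 2%:E * \sum_i \int[Q]_y sqincr P (fun x => k i (x, y)).
Proof.
move=> mk fk; rewrite tensor_sqincr// leeD2l// mixed_right//.
have k0 i (u : X * X) : 0 <= \int[Q]_y ((k i (u.1, y) - k i (u.2, y)) ^+ 2)%:E.
  by apply: integral_ge0 => y _; rewrite lee_fin sqr_ge0.
have -> : \sum_i \int[Q]_y sqincr P (fun x => k i (x, y)) =
    \int[PP]_u \sum_i \int[Q]_y ((k i (u.1, y) - k i (u.2, y)) ^+ 2)%:E.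
  rewrite ge0_integral_sum//.
    by apply: eq_bigr => i _; rewrite integral_sqdiff_left.
  by move=> i; exact: measurable_sqdiff_left.
have ms : measurable_fun [set: X * X]
    (fun u => \sum_i \int[Q]_y ((k i (u.1, y) - k i (u.2, y)) ^+ 2)%:E).
  by apply: emeasurable_sum => i; exact: measurable_sqdiff_left.
apply: ge0_le_integralZl => //.
- exact: mright.
- by move=> u; exact: sqincr_ge0.
- by move=> u; exact: sume_ge0.
Qed.

End mixed_bounds.

(** * The inequalities in dimension n *)

Section Ck_lemmas.
Context {R : realType} (n : nat).
Implicit Types (f g : 'rV[R]_n -> R).

Lemma partialB i f g : (forall x, derivable f x (delta_mx ord0 i)) ->
  (forall x, derivable g x (delta_mx ord0 i)) ->
  partial i (f \- g) = partial i f \- partial i g.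
Proof. by move=> df dg; apply/funext => x; exact: deriveB. Qed.

Lemma partialD i f g : (forall x, derivable f x (delta_mx ord0 i)) ->
  (forall x, derivable g x (delta_mx ord0 i)) ->
  partial i (f \+ g) = partial i f \+ partial i g.
Proof. by move=> df dg; apply/funext => x; exact: deriveD. Qed.

Lemma partialZ i (c : R) f : (forall x, derivable f x (delta_mx ord0 i)) ->
  partial i (c \*o f) = c \*o partial i f.
Proof. by move=> df; apply/funext => x; exact: deriveZ. Qed.

Lemma continuousZ_fun (c : R) f : continuous f -> continuous (c \*o f).
Proof. by move=> cf x; exact: (cvgM (@cst_continuous _ _ c x) (cf x)). Qed.

Lemma CkD k f g : Ck k f -> Ck k g -> Ck k (f \+ g).
Proof.
elim: k f g => [|k IH] f g /=; first by move=> cf cg x;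
  exact: (cvgD (cf x) (cg x)).
move=> [cf df] [cg dg]; split; first by move=> x; exact: (cvgD (cf x) (cg x)).
move=> i; have [dfi Cfi] := df i; have [dgi Cgi] := dg i.
split; first by move=> x; exact: (derivableD (dfi x) (dgi x)).
by rewrite (partialD dfi dgi); exact: IH.
Qed.

Lemma CkB k f g : Ck k f -> Ck k g -> Ck k (f \- g).
Proof.
elim: k f g => [|k IH] f g /=; first by move=> cf cg x;
  exact: (cvgB (cf x) (cg x)).
move=> [cf df] [cg dg]; split; first by move=> x; exact: (cvgB (cf x) (cg x)).
move=> i; have [dfi Cfi] := df i; have [dgi Cgi] := dg i.
split; first by move=> x; exact: (derivableB (dfi x) (dgi x)).
by rewrite (partialB dfi dgi); exact: IH.
Qed.

Lemma CkZ k (c : R) f : Ck k f -> Ck k (c \*o f).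
Proof.
elim: k f => [|k IH] f; first exact: continuousZ_fun.
move=> [cf df]; split; first exact: continuousZ_fun.
move=> i; have [dfi Cfi] := df i.
by split; [move=> x; exact: derivableZ|rewrite partialZ//; exact: IH].
Qed.

Lemma CkS_partial k i f : Ck k.+1 f -> Ck k (partial i f).
Proof. by move=> [_ /(_ i)[]]. Qed.

Lemma CkS_derivable k i f : Ck k.+1 f ->
  forall x, derivable f x (delta_mx ord0 i).
Proof. by move=> [_ /(_ i)[]]. Qed.

Lemma CkW k f : Ck k.+1 f -> Ck k f.
Proof.
elim: k f => [|k IH] f; first by case.
move=> [cf df]; split => // i; have [dfi Cfi] := df i; split => //.
exact: IH.
Qed.

End Ck_lemmas.

Lemma sum_ord_recl2 (R : realType) n (F : 'I_n.+1 -> 'I_n.+1 -> \bar R) :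
  (\sum_(i < n.+1) \sum_(j < n.+1) F i j =
   (\sum_(i < n) F (lift ord0 i) ord0 + \sum_(j < n) F ord0 (lift ord0 j)) +
   (F ord0 ord0 + \sum_(i < n) \sum_(j < n) F (lift ord0 i) (lift ord0 j)))%E.
Proof.
rewrite big_ord_recl big_ord_recl.
under [X in (_ + X)%E = _]eq_bigr do rewrite big_ord_recl.
rewrite big_split/= [X in (X + _)%E = _]addeC addeACA; congr (_ + _)%E.
exact: addeC.
Qed.

Section square_integral.
Context d (T : measurableType d) (R : realType) (m : {measure set T -> \bar R}).
Local Open Scope ereal_scope.
Implicit Types u v : T -> R.

Definition sqint u : \bar R := \int[m]_x ((u x) ^+ 2)%:E.

Lemma sqint_ge0 u : 0 <= sqint u.
Proof. by apply: integral_ge0 => x _; rewrite lee_fin sqr_ge0. Qed.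

Let msq u : measurable_fun [set: T] u ->
  measurable_fun [set: T] (fun x => ((u x) ^+ 2)%:E).
Proof. by move=> mu; apply/measurable_EFinP; exact: measurable_funX. Qed.

Let sq0 u x : 0 <= ((u x) ^+ 2)%:E. Proof. by rewrite lee_fin sqr_ge0. Qed.

Let intZ (c : R) (g : T -> \bar R) : measurable_fun [set: T] g ->
  (forall x, 0 <= g x) -> (0 <= c)%R ->
    \int[m]_x (c%:E * g x) = c%:E * \int[m]_x g x.
Proof. by move=> mg g0 c0; rewrite ge0_integralZl// lee_fin. Qed.

(** An identity between integrals of nonnegative functions, so the cross term never has to be
    integrable. *)
Lemma sqint_parallelogram u v : measurable_fun [set: T] u ->
  measurable_fun [set: T] v ->
  sqint (fun x => u x + v x)%R + sqint (fun x => u x - v x)%R =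
  2%:E * (sqint u + sqint v).
Proof.
move=> mu mv.
have mD := msq (measurable_funD mu mv).
have mB := msq (measurable_funB mu mv).
rewrite /sqint -(ge0_integralD m measurableT (fun x _ => sq0 (u \+ v)%R x) mD
  (fun x _ => sq0 (u \- v)%R x) mB).
rewrite -(ge0_integralD m measurableT (fun x _ => sq0 u x) (msq mu)
  (fun x _ => sq0 v x) (msq mv)).
rewrite -(intZ (emeasurable_funD (msq mu) (msq mv))
  (fun x => adde_ge0 (sq0 u x) (sq0 v x)))//.
by apply: eq_integral => x _; rewrite -!EFinD -EFinM; congr EFin; rewrite /=;
  ring.
Qed.

Lemma sqintZ (c : R) u : measurable_fun [set: T] u ->
  sqint (fun x => c * u x)%R = (c ^+ 2)%:E * sqint u.
Proof.
move=> mu; rewrite /sqint -(intZ (msq mu) (sq0 u) (sqr_ge0 c)).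
by apply: eq_integral => x _; rewrite -EFinM exprMn.
Qed.

End square_integral.

Section energy.
Context {R : realType}.
Local Open Scope ereal_scope.

Definition sqnorm n (u : 'rV[R]_n -> R) : \bar R :=
  sqint (gauss n) u.

Definition grad_energy n (f : 'rV[R]_n -> R) : \bar R :=
  \sum_(i < n) sqnorm (partial i f).

Definition hess_energy n (f : 'rV[R]_n -> R) : \bar R :=
  \sum_(i < n) \sum_(j < n) sqnorm (partial i (partial j f)).

Lemma sqnorm_ge0 n (u : 'rV[R]_n -> R) : 0 <= sqnorm u.
Proof. exact: sqint_ge0. Qed.

Lemma grad_energy_ge0 n (f : 'rV[R]_n -> R) : 0 <= grad_energy f.
Proof. by apply: sume_ge0 => i _; exact: sqnorm_ge0. Qed.

Lemma hess_energy_ge0 n (f : 'rV[R]_n -> R) : 0 <= hess_energy f.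
Proof. by do 2 (apply: sume_ge0 => ? _); exact: sqnorm_ge0. Qed.

End energy.

(** * Induction on the dimension *)

Section induction_step.
Context {R : realType} (n : nat).
Notation gam := (@normal_prob R 0 1).
Implicit Types (u f : 'rV[R]_n.+1 -> R).
Local Open Scope ereal_scope.

Let uncurry u (p : R * 'rV[R]_n) := u (rV_cons p).

Let muncurry u : continuous u -> measurable_fun [set: R * 'rV[R]_n] (uncurry u).
Proof.
move=> cu.
exact: (measurableT_comp (continuous_measurable_rV cu)
  (@measurable_rV_cons R n)).
Qed.

Let msqr d (T : measurableType d) (v : T -> R) : measurable_fun [set: T] v ->
  measurable_fun [set: T] (fun x => ((v x) ^+ 2)%:E).
Proof. by move=> mv; apply/measurable_EFinP; exact: measurable_funX. Qed.

Lemma sqnormE u : continuous u ->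
  sqnorm u = \int[gam]_a sqnorm (fun y => u (rV_cons (a, y))).
Proof.
move=> cu; rewrite /sqnorm /sqint integral_gauss_cons//.
  by apply: msqr; exact: continuous_measurable_rV.
by move=> x; rewrite lee_fin sqr_ge0.
Qed.

Lemma sqnormE_swap u : continuous u ->
  sqnorm u = \int[gauss n]_y \int[gam]_a ((u (rV_cons (a, y))) ^+ 2)%:E.
Proof.
move=> cu; rewrite sqnormE//.
rewrite -(@fubini_tonelli _ _ _ _ _ gam (gauss n)
  (fun p => (u (rV_cons p) ^+ 2)%:E))//.
  exact: (msqr (muncurry cu)).
by move=> x; rewrite lee_fin sqr_ge0.
Qed.

Lemma measurable_sqnorm_rV_consr u : continuous u ->
  measurable_fun [set: R] (fun a => sqnorm (fun y => u (rV_cons (a, y)))).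
Proof.
move=> cu; apply: (@measurable_fun_fubini_tonelli_F _ _ _ _ _ (gauss n)
  (fun p => (u (rV_cons p) ^+ 2)%:E)).
  exact: (msqr (muncurry cu)).
by move=> x; rewrite lee_fin sqr_ge0.
Qed.

Lemma measurable_sqint_rV_consl u : continuous u ->
  measurable_fun [set: 'rV[R]_n]
    (fun y => \int[gam]_a ((u (rV_cons (a, y))) ^+ 2)%:E).
Proof.
move=> cu; apply: (@measurable_fun_fubini_tonelli_G _ _ _ _ _ gam
  (fun p => (u (rV_cons p) ^+ 2)%:E)).
  exact: (msqr (muncurry cu)).
by move=> x; rewrite lee_fin sqr_ge0.
Qed.

Lemma sqincr_gauss_cons u : continuous u ->
  sqincr (gauss n.+1) u = \int[gam]_a \int[gauss n]_y \int[gam]_a'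
    \int[gauss n]_y'
    ((u (rV_cons (a, y)) - u (rV_cons (a', y'))) ^+ 2)%:E.
Proof.
move=> cu; have mu := continuous_measurable_rV cu.
have K0 (p : 'rV[R]_n.+1 * 'rV[R]_n.+1) : 0 <= ((u p.1 - u p.2) ^+ 2)%:E.
  by rewrite lee_fin sqr_ge0.
rewrite /sqincr integral_gauss_cons.
- apply: eq_integral => a _; apply: eq_integral => y _.
  rewrite integral_gauss_cons//; last by move=> x; rewrite lee_fin sqr_ge0.
  by apply: msqr; exact: measurable_funB.
- apply: (@measurable_fun_fubini_tonelli_F _ _ _ _ _ (gauss n.+1)
    (fun p : 'rV[R]_n.+1 * 'rV[R]_n.+1 => ((u p.1 - u p.2) ^+ 2)%:E)) => //.
  by apply: msqr; apply: measurable_funB; exact: measurableT_comp.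
- by move=> x; apply: integral_ge0 => y _; rewrite lee_fin sqr_ge0.
Qed.

(** [L] is twice the variance in the first coordinate and [Rt] twice the variance in the remaining
    ones, each averaged over the other variables. *)
Let L u := \int[gauss n]_y sqincr gam (fun a => u (rV_cons (a, y))).
Let Rt u := \int[gam]_a sqincr (gauss n) (fun y => u (rV_cons (a, y))).
Let LR_le u : continuous u -> sqincr (gauss n.+1) u <= L u + Rt u.
Proof.
move=> cu; rewrite sqincr_gauss_cons//.
exact: (tensor_sqincr_le gam (gauss n) (muncurry cu)).
Qed.

Let L_ge0 u : 0 <= L u.
Proof. by apply: integral_ge0 => y _; exact: sqincr_ge0. Qed.
Let Rt_ge0 u : 0 <= Rt u.
Proof. by apply: integral_ge0 => y _; exact: sqincr_ge0. Qed.
Let mL u : continuous u ->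
  measurable_fun [set: 'rV[R]_n]
    (fun y => sqincr gam (fun a => u (rV_cons (a, y)))).
Proof. by move=> cu; exact: (measurable_sqincr_left gam (muncurry cu)). Qed.

Let mRt u : continuous u ->
  measurable_fun [set: R] (fun a => sqincr (gauss n)
    (fun y => u (rV_cons (a, y)))).
Proof.
by move=> cu; exact: (measurable_sqincr_right (gauss n) (muncurry cu)).
Qed.

Let two_ge0 : 0 <= 2%:E :> \bar R. Proof. by rewrite lee_fin. Qed.

Let continuous_consl u y : continuous u ->
  continuous (fun a : R => u (rV_cons (a, y))).
Proof.
by move=> cu a; exact: (continuous_comp (@continuous_rV_consl R n y a) (cu _)).
Qed.

Let L_le u : Ck 1 u -> L u <= 2%:E * sqnorm (partial ord0 u).
Proof.
move=> Cu; have cu := Ck_continuous Cu; have cpu := CkS_partial ord0 Cu.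
rewrite (sqnormE_swap cpu); apply: ge0_le_integralZl => //.
- exact: mL.
- by move=> y; exact: sqincr_ge0.
- exact: measurable_sqint_rV_consl.
- by move=> y; apply: integral_ge0 => a _; rewrite lee_fin sqr_ge0.
- move=> y; apply: poincare_normal; last exact: continuous_consl.
  by move=> a; apply: is_derive_rV_consl; exact: CkS_derivable Cu.
Qed.

Hypothesis IH1 : forall g : 'rV[R]_n -> R, Ck 1 g ->
  sqincr (gauss n) g <= 2%:E * grad_energy g.

Let gradE u a : grad_energy (fun y => u (rV_cons (a, y))) =
  \sum_(j < n) sqnorm (fun y => partial (lift ord0 j) u (rV_cons (a, y))).
Proof. by apply: eq_bigr => j _; rewrite partial_rV_consr. Qed.

Let int_grad u : Ck 1 u ->
  \int[gam]_a grad_energy (fun y => u (rV_cons (a, y))) =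
  \sum_(j < n) sqnorm (partial (lift ord0 j) u).
Proof.
move=> Cu; have cpu j := CkS_partial j Cu.
under eq_integral do rewrite gradE.
rewrite ge0_integral_sum//.
- by apply: eq_bigr => j _; rewrite -sqnormE//; exact: cpu.
- by move=> j; apply: measurable_sqnorm_rV_consr; exact: cpu.
- by move=> j a _; exact: sqnorm_ge0.
Qed.

Let mgrad u : Ck 1 u ->
  measurable_fun [set: R] (fun a => grad_energy (fun y => u (rV_cons (a, y)))).
Proof.
move=> Cu; under eq_fun do rewrite gradE.
apply: emeasurable_sum => j; apply: measurable_sqnorm_rV_consr.
exact: CkS_partial Cu.
Qed.

Let Rt_le u : Ck 1 u ->
  Rt u <= 2%:E * \sum_(j < n) sqnorm (partial (lift ord0 j) u).
Proof.
move=> Cu; have cu := Ck_continuous Cu.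
rewrite -(int_grad Cu); apply: ge0_le_integralZl => //.
- exact: mRt.
- by move=> a; exact: sqincr_ge0.
- exact: mgrad.
- by move=> a; exact: grad_energy_ge0.
- by move=> a; apply: IH1; exact: Ck_rV_consr.
Qed.

Lemma poincare_step u : Ck 1 u ->
  sqincr (gauss n.+1) u <= 2%:E * grad_energy u.
Proof.
move=> Cu; have cu := Ck_continuous Cu.
apply: (le_trans (LR_le cu)).
rewrite /grad_energy big_ord_recl ge0_muleDr//; last 2 first.
- exact: sqnorm_ge0.
- by apply: sume_ge0 => j _; exact: sqnorm_ge0.
by apply: leeD; [exact: L_le|exact: Rt_le].
Qed.

Hypothesis IH2 : forall g : 'rV[R]_n -> R, Ck 2 g ->
  2%:E * grad_energy g <= sqincr (gauss n) g + hess_energy g.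

Let hessE u a : hess_energy (fun y => u (rV_cons (a, y))) =
  \sum_(i < n) \sum_(j < n)
    sqnorm (fun y => partial (lift ord0 i) (partial (lift ord0 j) u)
      (rV_cons (a, y))).
Proof.
by apply: eq_bigr => i _; apply: eq_bigr => j _; rewrite !partial_rV_consr.
Qed.

Let cpp u i j : Ck 2 u -> continuous (partial i (partial j u)).
Proof. by move=> Cu; exact: CkS_partial (CkS_partial j Cu). Qed.

Let mhess u : Ck 2 u ->
  measurable_fun [set: R] (fun a => hess_energy (fun y => u (rV_cons (a, y)))).
Proof.
move=> Cu; under eq_fun do rewrite hessE.
apply: emeasurable_sum => i; apply: emeasurable_sum => j.
by apply: measurable_sqnorm_rV_consr; exact: cpp.
Qed.

Let int_hess u : Ck 2 u ->
  \int[gam]_a hess_energy (fun y => u (rV_cons (a, y))) =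
  \sum_(i < n) \sum_(j < n) sqnorm
    (partial (lift ord0 i) (partial (lift ord0 j) u)).
Proof.
move=> Cu; under eq_integral do rewrite hessE.
have mij i j : measurable_fun [set: R] (fun a =>
    sqnorm (fun y => partial (lift ord0 i) (partial (lift ord0 j) u)
      (rV_cons (a, y)))).
  by apply: measurable_sqnorm_rV_consr; exact: cpp.
rewrite ge0_integral_sum//.
- apply: eq_bigr => i _; rewrite ge0_integral_sum//.
  + by apply: eq_bigr => j _; rewrite -sqnormE//; exact: cpp.
  + by move=> j; exact: mij.
  + by move=> j a _; exact: sqnorm_ge0.
- by move=> i; apply: emeasurable_sum => j; exact: mij.
- by move=> i a _; apply: sume_ge0 => j _; exact: sqnorm_ge0.
Qed.

Let L_ge u : Ck 2 u -> 2%:E * sqnorm (partial ord0 u) <=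
  L u + sqnorm (partial ord0 (partial ord0 u)).
Proof.
move=> Cu; have cu := Ck_continuous Cu.
have cpu := Ck_continuous (CkS_partial ord0 Cu).
have cppu : continuous (partial ord0 (partial ord0 u)) by exact: cpp.
have int_ge0 v (y : 'rV[R]_n) : 0 <= \int[gam]_a ((v (rV_cons (a, y))) ^+ 2)%:E.
  by apply: integral_ge0 => a _; rewrite lee_fin sqr_ge0.
rewrite (sqnormE_swap cpu) (sqnormE_swap cppu); apply: ge0_le_integralDZ => //.
- exact: measurable_sqint_rV_consl.
- exact: mL.
- by move=> y; exact: sqincr_ge0.
- exact: measurable_sqint_rV_consl.
- move=> y; apply: second_order_poincare_normal.
  + by move=> a; apply: is_derive_rV_consl; exact: CkS_derivable Cu.
  + exact: continuous_consl.
  + move=> a; apply: is_derive_rV_consl.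
    exact: CkS_derivable (CkS_partial ord0 Cu).
  + exact: continuous_consl.
Qed.

Let Rt_ge u : Ck 2 u -> 2%:E * \sum_(j < n) sqnorm (partial (lift ord0 j) u) <=
  Rt u + \sum_(i < n) \sum_(j < n) sqnorm
    (partial (lift ord0 i) (partial (lift ord0 j) u)).
Proof.
move=> Cu; have cu := Ck_continuous Cu; have C1u := CkW Cu.
rewrite -[X in _ * X <= _](int_grad C1u) -[X in _ <= _ + X](int_hess Cu) /Rt.
have two0 : (0 <= 2 :> R)%R by [].
apply: (ge0_le_integralDZ gam two0 (mgrad C1u) (fun a => grad_energy_ge0 _)
  (mRt cu) (fun a => sqincr_ge0 _ _) (mhess Cu) (fun a => hess_energy_ge0 _))
    => a.
by apply: IH2; exact: Ck_rV_consr.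
Qed.

(* Bounding the mixed increments by either order of differentiation and
   averaging avoids the symmetry of second derivatives. *)
Let mixed_le1 u : Ck 2 u -> 2%:E * L u + 2%:E * Rt u <=
  2%:E * sqincr (gauss n.+1) u +
  2%:E * (2%:E * \sum_(j < n) sqnorm (partial (lift ord0 j) (partial ord0 u))).
Proof.
move=> Cu; have cu := Ck_continuous Cu; have C1p := CkS_partial ord0 Cu.
have cp := Ck_continuous C1p.
(* Poincaré in the first coordinate, applied to a difference of two sections of [u], leaves
   [Rt (partial ord0 u)]; the second factor 2 comes from [Rt_le]. *)
apply: (@le_trans _ _ (2%:E * sqincr (gauss n.+1) u + 2%:E * Rt
  (partial ord0 u))).
  rewrite (sqincr_gauss_cons cu).
  refine (@tensor_le_right _ _ _ _ _ gam (gauss n) _ (muncurry cu) _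
    (muncurry cp) _) => y y'.
  apply: poincare_normal.
    move=> a; have dl z := is_derive_rV_consl a z (CkS_derivable Cu).
    have ? := dl y; have ? := dl y'; exact: is_deriveB.
  by move=> a; apply: cvgB; exact: continuous_consl.
by apply: leeD2l; apply: lee_wpmul2l => //; exact: Rt_le.
Qed.

(** Here [IH1] handles the difference of two sections in the last coordinates first, and the
    inequality on the line is then applied to each partial derivative. *)
Let mixed_le2 u : Ck 2 u -> 2%:E * L u + 2%:E * Rt u <=
  2%:E * sqincr (gauss n.+1) u +
  2%:E * (2%:E * \sum_(j < n) sqnorm (partial ord0 (partial (lift ord0 j) u))).
Proof.
move=> Cu; have cu := Ck_continuous Cu; have C1u := CkW Cu.
have C1p j := CkS_partial (lift ord0 j) Cu.
apply: (@le_trans _ _ (2%:E * sqincr (gauss n.+1) u +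
    2%:E * \sum_(j < n) L (partial (lift ord0 j) u))).
  rewrite (sqincr_gauss_cons cu).
  refine (@tensor_le_left _ _ _ _ _ gam (gauss n) _ (muncurry cu) _ _
    (fun j => muncurry (Ck_continuous (C1p j))) _) => a a'.
  apply: le_trans.
    by apply: IH1; apply: CkB; exact: Ck_rV_consr.
  apply: lee_wpmul2l => //; rewrite le_eqVlt; apply/orP; left; apply/eqP.
  apply: eq_bigr => j _.
  have dr b y : derivable (fun y => u (rV_cons (b, y))) y (delta_mx ord0 j).
    exact: derivable_rV_consr (@CkS_derivable R n.+1 0 (lift ord0 j) u C1u
      (rV_cons (b, y))).
  by rewrite (partialB (dr a) (dr a')) !partial_rV_consr.
apply: leeD2l; apply: lee_wpmul2l => //.
rewrite ge0_sume_distrr; last by move=> j _; exact: sqnorm_ge0.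
by apply: lee_sum => j _; exact: L_le.
Qed.

(** The bound with the smaller of [x] and [x'] is enough, since twice the minimum is at most their
    sum; this also covers infinite values. *)
Let avg_le (a w x x' : \bar R) : 0 <= a -> 0 <= w -> 0 <= x -> 0 <= x' ->
  2%:E * a <= 2%:E * w + 2%:E * (2%:E * x) ->
  2%:E * a <= 2%:E * w + 2%:E * (2%:E * x') -> a <= w + (x + x').
Proof.
have two (z : \bar R) : 0 <= z -> 2%:E * z = z + z.
  move=> z0; rewrite (_ : 2%:E = 1%:E + 1%:E); last by rewrite -EFinD.
  by rewrite ge0_muleDl// !mul1e.
move=> a0 w0 x0 x'0.
rewrite -!ge0_muleDr ?mule_ge0// !lee_pmul2l// !two// => ax ax'.
have [xx'|/ltW x'x] := leP x x'.
- by apply: (le_trans ax); apply: leeD2l; exact: leeD2l.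
- by apply: (le_trans ax'); apply: leeD2l; exact: leeD2r.
Qed.

Lemma second_order_step u : Ck 2 u ->
  2%:E * grad_energy u <= sqincr (gauss n.+1) u + hess_energy u.
Proof.
move=> Cu.
set X := \sum_(j < n) sqnorm (partial (lift ord0 j) (partial ord0 u)).
set X' := \sum_(j < n) sqnorm (partial ord0 (partial (lift ord0 j) u)).
set H0 := sqnorm (partial ord0 (partial ord0 u)).
set H1 := \sum_(i < n) \sum_(j < n)
  sqnorm (partial (lift ord0 i) (partial (lift ord0 j) u)).
have X0 : 0 <= X by apply: sume_ge0 => j _; exact: sqnorm_ge0.
have X'0 : 0 <= X' by apply: sume_ge0 => j _; exact: sqnorm_ge0.
have HE : hess_energy u = (X + X') + (H0 + H1).
  exact: (sum_ord_recl2 (fun i j => sqnorm (partial i (partial j u)))).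
(* [X] and [X'] are the two off-diagonal blocks of the Hessian. They pay for replacing [L u + Rt u]
   by the full increment, while the diagonal blocks [H0] and [H1] come from the inequality in each
   factor. *)
have LRW : L u + Rt u <= sqincr (gauss n.+1) u + (X + X').
  apply: (avg_le (adde_ge0 (L_ge0 u) (Rt_ge0 u)) (sqincr_ge0 _ _) X0 X'0).
  - rewrite (ge0_muleDr _ (L_ge0 u) (Rt_ge0 u)); exact: mixed_le1.
  - rewrite (ge0_muleDr _ (L_ge0 u) (Rt_ge0 u)); exact: mixed_le2.
rewrite HE addeA; apply: (le_trans _ (leeD2r _ LRW)).
have S0 : 0 <= \sum_(j < n) sqnorm (partial (lift ord0 j) u).
  by apply: sume_ge0 => j _; exact: sqnorm_ge0.
rewrite [leRHS]addeACA /grad_energy big_ord_recl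
  (ge0_muleDr _ (sqnorm_ge0 _) S0).
by apply: leeD; [exact: L_ge|exact: Rt_ge].
Qed.

End induction_step.

Section gaussian_inequalities.
Context {R : realType}.
Local Open Scope ereal_scope.

Let sqincr0 (g : 'rV[R]_0 -> R) : sqincr (gauss 0) g = 0.
Proof.
apply: integral0_eq => x _; apply: integral0_eq => y _.
by rewrite (_ : x = y) ?subrr ?expr0n//; apply/rowP => -[].
Qed.

Theorem poincare_gauss n (f : 'rV[R]_n -> R) : Ck 1 f ->
  sqincr (gauss n) f <= 2%:E * grad_energy f.
Proof.
elim: n f => [|n IH] f Cf; last exact: poincare_step.
by rewrite sqincr0 mule_ge0 ?grad_energy_ge0 ?lee_fin.
Qed.

Theorem second_order_poincare_gauss n (f : 'rV[R]_n -> R) : Ck 2 f ->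
  2%:E * grad_energy f <= sqincr (gauss n) f + hess_energy f.
Proof.
elim: n f => [|n IH] f Cf.
  by rewrite /grad_energy big_ord0 mule0 adde_ge0 ?sqincr_ge0 ?hess_energy_ge0.
by apply: second_order_step => // g; exact: poincare_gauss.
Qed.

End gaussian_inequalities.

(** * Variance and finiteness of the energies *)

Section variance.
Context d (T : measurableType d) (R : realType) (P : probability T R).
Local Open Scope ereal_scope.

(** A finite second moment makes [f] integrable, because |f| <= 1 + f^2, so the square of the
    increment may be expanded term by term. *)
Lemma sqincr_variance (f : T -> R) : measurable_fun [set: T] f ->
  \int[P]_x ((f x) ^+ 2)%:E < +oo -> exists m s : R,
  [/\ \int[P]_x (f x)%:E = m%:E, \int[P]_x ((f x) ^+ 2)%:E = s%:E &
      sqincr P f = (2 * (s - m ^+ 2))%:E].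
Proof.
move=> mf f2oo.
have mf2 : measurable_fun [set: T] (fun x => (f x ^+ 2)%R)
  by exact: measurable_funX.
have if2 : P.-integrable [set: T] (EFin \o (fun x => (f x ^+ 2)%R)).
  apply/integrableP; split; first exact/measurable_EFinP.
  by under eq_integral do rewrite /= ger0_norm ?sqr_ge0//.
have icst (c : R) : P.-integrable [set: T] (EFin \o cst c).
  exact: finite_measure_integrable_cst.
have if1 : P.-integrable [set: T] (EFin \o f).
  apply: (@le_integrable _ _ _ P _ measurableT _
    (EFin \o (fun x => (1 + f x ^+ 2)%R))) => //.
  - exact/measurable_EFinP.
  - move=> x _; rewrite /= lee_fin (ger0_norm (_ : 0 <= 1 + f x ^+ 2)%R).
      by rewrite ler_norml; apply/andP; split; nra.
    by rewrite addr_ge0// sqr_ge0.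
  - have -> : (EFin \o (fun x => (1 + f x ^+ 2)%R)) =
        (EFin \o cst 1%R) \+ (EFin \o (fun x => (f x ^+ 2)%R)) by [].
    exact: integrableD.
have [m mE] : exists m : R, \int[P]_x (f x)%:E = m%:E.
  exists (fine (\int[P]_x (f x)%:E)); rewrite fineK//.
  exact: (integrable_fin_num measurableT if1).
have [s sE] : exists s : R, \int[P]_x ((f x) ^+ 2)%:E = s%:E.
  exists (fine (\int[P]_x (f x ^+ 2)%:E)); rewrite fineK//.
  exact: (integrable_fin_num measurableT if2).
exists m, s; split => //.
(* Used twice: for the inner integral with [a] and [b] depending on [f x], then for the outer one
   with [s] and [- 2 * m]. *)
have quad (a b : R) : \int[P]_x (a + b * f x + f x ^+ 2)%:E =
  (a + b * m + s)%:E.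
  have ib : P.-integrable [set: T] (fun x => (b * f x)%:E).
    by under eq_fun do rewrite EFinM; exact: integrableZl.
  have iab : P.-integrable [set: T] (fun x => a%:E + (b * f x)%:E).
    exact: (integrableD measurableT (icst a) ib).
  under eq_integral do rewrite !EFinD.
  have qa : \int[P]_x (EFin \o cst a) x = a%:E by have :=
    prob_integral_cst P a%:E.
  have qb : \int[P]_x (b * f x)%:E = (b * m)%:E.
    by under eq_integral do rewrite EFinM; rewrite integralZl// mE -EFinM.
  rewrite (integralD measurableT iab if2) (integralD measurableT (icst a) ib).
  by rewrite qa qb sE.
rewrite /sqincr.
transitivity (\int[P]_x ((s + (- 2 * m) * f x + f x ^+ 2)%:E)).
  apply: eq_integral => x _; rewrite -[X in (X + _)%R]addrC.
  transitivity (\int[P]_y (f x ^+ 2 + (- 2 * f x) * f y + f y ^+ 2)%:E).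
    by apply: eq_integral => y _; congr EFin; ring.
  by rewrite quad; congr EFin; ring.
by rewrite quad; congr EFin; ring.
Qed.

End variance.

Section functional.
Context {R : realType} (n : nat).
Implicit Type f : 'rV[R]_n -> R.
Local Open Scope ereal_scope.

Let msq (u : 'rV[R]_n -> R) : continuous u ->
  measurable_fun [set: 'rV[R]_n] (fun x => ((u x) ^+ 2)%:E).
Proof.
move=> cu; apply/measurable_EFinP; apply: measurable_funX.
exact: continuous_measurable_rV.
Qed.

Let sq0 (u : 'rV[R]_n -> R) x : 0 <= ((u x) ^+ 2)%:E.
Proof. by rewrite lee_fin sqr_ge0. Qed.

Lemma sqr_normHS (A : 'M[R]_n) : (normHS A ^+ 2 = \sum_i \sum_j A i j ^+ 2)%R.
Proof.
by rewrite sqr_sqrtr// sumr_ge0// => i _; apply: sumr_ge0 => j _;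
  exact: sqr_ge0.
Qed.

Let msumgrad f : Ck 1 f ->
  measurable_fun [set: 'rV[R]_n] (fun x => (norm2 (grad f x) ^+ 2)%:E).
Proof.
move=> Cf; apply/measurable_EFinP; under eq_fun do rewrite sqr_norm2.
apply: measurable_sum => i; under eq_fun do rewrite mxE.
apply: measurable_funX; apply: continuous_measurable_rV.
exact: CkS_partial Cf.
Qed.

Let msumhess f : Ck 2 f ->
  measurable_fun [set: 'rV[R]_n] (fun x => (normHS (hess f x) ^+ 2)%:E).
Proof.
move=> Cf; apply/measurable_EFinP; under eq_fun do rewrite sqr_normHS.
apply: measurable_sum => i; apply: measurable_sum => j;
  under eq_fun do rewrite mxE.
apply: measurable_funX; apply: continuous_measurable_rV.
exact: CkS_partial (CkS_partial j Cf).
Qed.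

Lemma grad_energyE f : Ck 1 f ->
  \int[gauss n]_x (norm2 (grad f x) ^+ 2)%:E = grad_energy f.
Proof.
move=> Cf; rewrite /grad_energy /sqnorm /sqint -ge0_integral_sum//.
- apply: eq_integral => x _; rewrite sqr_norm2 -sumEFin.
  by apply: eq_bigr => i _; rewrite mxE.
- by move=> i; apply: msq; exact: CkS_partial Cf.
Qed.

Lemma hess_energyE f : Ck 2 f ->
  \int[gauss n]_x (normHS (hess f x) ^+ 2)%:E = hess_energy f.
Proof.
move=> Cf.
have m2 i j : measurable_fun [set: 'rV[R]_n]
    (fun x => ((partial i (partial j f) x) ^+ 2)%:E).
  by apply: msq; exact: CkS_partial (CkS_partial j Cf).
transitivity (\sum_(i < n) \int[gauss n]_x
    \sum_(j < n) ((partial i (partial j f) x) ^+ 2)%:E).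
  rewrite -ge0_integral_sum//.
  - apply: eq_integral => x _; rewrite sqr_normHS -sumEFin.
    apply: eq_bigr => i _; rewrite -sumEFin.
    by apply: eq_bigr => j _; rewrite mxE.
  - by move=> i; apply: emeasurable_sum => j; exact: m2.
  - by move=> i x _; apply: sume_ge0 => j _; exact: sq0.
by apply: eq_bigr => i _; rewrite ge0_integral_sum.
Qed.

(** The gradient energy is finite because [second_order_poincare_gauss] bounds it by two finite
    terms. The integral of the difference then splits, and what remains is real arithmetic. *)
Lemma functional_values f : Ck 2 f -> sqnorm f < +oo -> hess_energy f < +oo ->
  exists G H V : R, [/\ grad_energy f = G%:E, hess_energy f = H%:E,
    sqincr (gauss n) f = (2 * V)%:E, gauss_var f = V%:E &
    \int[gauss n]_x (norm2 (grad f x) ^+ 2 - normHS (hess f x) ^+ 2 / 2)%:E =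
    (G - H / 2)%:E].
Proof.
move=> Cf foo Hoo.
have mf := continuous_measurable_rV (Ck_continuous Cf).
have [m [s [mE sE VE]]] := sqincr_variance mf foo.
have HE : hess_energy f = (fine (hess_energy f))%:E.
  by rewrite fineK// ge0_fin_numE// hess_energy_ge0.
have GE : grad_energy f = (fine (grad_energy f))%:E.
  rewrite fineK// ge0_fin_numE ?grad_energy_ge0//.
  have : 2%:E * grad_energy f < +oo.
    apply: le_lt_trans (second_order_poincare_gauss Cf) _.
    by rewrite VE HE -EFinD ltry.
  have := grad_energy_ge0 f; case: (grad_energy f) => [r _ _|_|//].
    exact: ltry.
  by rewrite gt0_muley.
move: (fine (hess_energy f)) HE => H HE;
  move: (fine (grad_energy f)) GE => G GE.
exists G, H, (s - m ^+ 2)%R; split => //.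
  by rewrite /gauss_var mE sE.
have ig : (gauss n).-integrable [set: 'rV[R]_n]
  (fun x => (norm2 (grad f x) ^+ 2)%:E).
  apply/integrableP; split; first by apply: msumgrad; exact: CkW.
  under eq_integral do rewrite /= ger0_norm ?sqr_ge0//.
  by rewrite grad_energyE ?GE ?ltry//; exact: CkW.
have ih0 : (gauss n).-integrable [set: 'rV[R]_n]
  (fun x => (normHS (hess f x) ^+ 2)%:E).
  apply/integrableP; split; first exact: msumhess.
  under eq_integral do rewrite /= ger0_norm ?sqr_ge0//.
  by rewrite hess_energyE// HE ltry.
have ih : (gauss n).-integrable [set: 'rV[R]_n]
    (fun x => (2^-1)%:E * (normHS (hess f x) ^+ 2)%:E) by exact: integrableZl.
transitivity (\int[gauss n]_x ((norm2 (grad f x) ^+ 2)%:E -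
    (2^-1)%:E * (normHS (hess f x) ^+ 2)%:E)).
  by apply: eq_integral => x _; rewrite -EFinM -EFinB [(2^-1 * _)%R]mulrC.
rewrite integralB// integralZl// hess_energyE// HE grad_energyE ?GE;
  last exact: CkW.
by rewrite -EFinM -EFinB mulrC.
Qed.

End functional.

Lemma second_order_inequality (R : realType) (n : nat) (phi : 'rV[R]_n -> R) :
  Ck 2 phi ->
  phi \in Lfun (gauss n) 2%:E ->
  (fun x => normHS (hess phi x)) \in Lfun (gauss n) 2%:E ->
  (\int[gauss n]_x
     (norm2 (grad phi x) ^+ 2 - normHS (hess phi x) ^+ 2 / 2)%:E
   <= gauss_var phi)%E.
Proof.
move=> C /Lfun2_integrable_sqr/integrableP[_ ioo]
  /Lfun2_integrable_sqr/integrableP[_ hoo].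
have foo : (sqnorm phi < +oo)%E.
  move: ioo; under eq_integral do rewrite /= ger0_norm ?sqr_ge0//.
  exact.
have Hoo : (hess_energy phi < +oo)%E.
  move: hoo; under eq_integral do rewrite /= ger0_norm ?sqr_ge0//.
  by rewrite hess_energyE.
have [G [H [V [GE HE WE -> ->]]]] := functional_values C foo Hoo.
have := second_order_poincare_gauss C.
by rewrite GE HE WE -EFinM -EFinD !lee_fin => ?; lra.
Qed.

(** * Equality for quadratic polynomials *)

Section saturation.
Context {R : realType} (n : nat).
Implicit Types f g : 'rV[R]_n -> R.
Local Open Scope ereal_scope.

(** Finiteness is part of the notion so that sums and multiples can be treated with real numbers. *)
Definition saturates f := [/\ Ck 2 f, sqnorm f < +oo, hess_energy f < +oo &
  2%:E * grad_energy f = sqincr (gauss n) f + hess_energy f].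

Let mC f : continuous f -> measurable_fun [set: 'rV[R]_n] f.
Proof. exact: continuous_measurable_rV. Qed.

Lemma sqnorm_parallelogram f g : continuous f -> continuous g ->
  sqnorm (f \+ g)%R + sqnorm (f \- g)%R = 2%:E * (sqnorm f + sqnorm g).
Proof.
by move=> cf cg; exact: (sqint_parallelogram (gauss n) (mC cf) (mC cg)).
Qed.

Lemma sqnormZ (c : R) f : continuous f ->
  sqnorm (c \*o f)%R = (c ^+ 2)%:E * sqnorm f.
Proof. by move=> cf; exact: (sqintZ (gauss n) c (mC cf)). Qed.

Lemma sqincrE d (T : measurableType d) (P : probability T R) (f : T -> R) :
  measurable_fun [set: T] f ->
  sqincr P f = sqint (P \x P) (fun p => f p.1 - f p.2)%R.
Proof.
move=> mf; rewrite /sqint fubini_tonelli1//.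
- apply/measurable_EFinP; apply: measurable_funX.
  by apply: measurable_funB; exact: measurableT_comp.
- by move=> p; rewrite lee_fin sqr_ge0.
Qed.

Let mincr f : continuous f ->
  measurable_fun [set: 'rV[R]_n * 'rV[R]_n] (fun p => f p.1 - f p.2)%R.
Proof.
by move=> cf; apply: measurable_funB; apply: measurableT_comp => //; exact: mC.
Qed.

Lemma sqincr_parallelogram f g : continuous f -> continuous g ->
  sqincr (gauss n) (f \+ g)%R + sqincr (gauss n) (f \- g)%R =
  2%:E * (sqincr (gauss n) f + sqincr (gauss n) g).
Proof.
move=> cf cg; have mf := mC cf; have mg := mC cg.
rewrite (sqincrE _ (measurable_funD mf mg)) (sqincrE _ (measurable_funB mf mg)).
rewrite (sqincrE _ mf) (sqincrE _ mg).
rewrite -(sqint_parallelogram _ (mincr cf) (mincr cg)).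
by congr (_ + _); congr (sqint _ _); apply/funext => p /=; ring.
Qed.

Lemma sqincrZ (c : R) f : continuous f ->
  sqincr (gauss n) (c \*o f)%R = (c ^+ 2)%:E * sqincr (gauss n) f.
Proof.
move=> cf; have mf := mC cf.
have mcf : measurable_fun [set: 'rV[R]_n] (c \*o f)%R.
  by apply: measurable_funM.
rewrite (sqincrE _ mcf) (sqincrE _ mf) -(sqintZ _ c (mincr cf)).
by congr (sqint _ _); apply/funext => p /=; ring.
Qed.

Let sum_parallelogram (I : finType) (a b c d : I -> \bar R) :
  (forall i, 0 <= c i) -> (forall i, 0 <= d i) ->
  (forall i, a i + b i = 2%:E * (c i + d i)) ->
  \sum_i a i + \sum_i b i = 2%:E * (\sum_i c i + \sum_i d i).
Proof.
move=> c0 d0 abcd; rewrite -!big_split/= ge0_sume_distrr.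
  by apply: eq_bigr => i _; exact: abcd.
by move=> i _; exact: adde_ge0.
Qed.

Let dC k i f : Ck k.+1 f -> forall x, derivable f x (delta_mx ord0 i).
Proof. by move=> Cf; exact: CkS_derivable Cf. Qed.

Lemma grad_energy_parallelogram f g : Ck 1 f -> Ck 1 g ->
  grad_energy (f \+ g)%R + grad_energy (f \- g)%R =
  2%:E * (grad_energy f + grad_energy g).
Proof.
move=> Cf Cg; apply: sum_parallelogram => [i|i|i]; try exact: sqnorm_ge0.
rewrite (partialD (@dC _ i _ Cf) (@dC _ i _ Cg))
  (partialB (@dC _ i _ Cf) (@dC _ i _ Cg)).
by apply: sqnorm_parallelogram; [exact: CkS_partial Cf|exact: CkS_partial Cg].
Qed.

Lemma grad_energyZ (c : R) f : Ck 1 f ->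
  grad_energy (c \*o f)%R = (c ^+ 2)%:E * grad_energy f.
Proof.
move=> Cf; rewrite /grad_energy ge0_sume_distrr.
  apply: eq_bigr => i _; rewrite (partialZ c (@dC _ i _ Cf)).
  by apply: sqnormZ; exact: CkS_partial Cf.
by move=> i _; exact: sqnorm_ge0.
Qed.

Lemma hess_energy_parallelogram f g : Ck 2 f -> Ck 2 g ->
  hess_energy (f \+ g)%R + hess_energy (f \- g)%R =
  2%:E * (hess_energy f + hess_energy g).
Proof.
move=> Cf Cg; apply: sum_parallelogram => [i|i|i];
  try (by apply: sume_ge0 => j _; exact: sqnorm_ge0).
apply: sum_parallelogram => [j|j|j]; try exact: sqnorm_ge0.
rewrite (partialD (@dC _ j _ Cf) (@dC _ j _ Cg))
  (partialB (@dC _ j _ Cf) (@dC _ j _ Cg)).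
have Cjf := CkS_partial j Cf; have Cjg := CkS_partial j Cg.
rewrite (partialD (@dC _ i _ Cjf) (@dC _ i _ Cjg))
  (partialB (@dC _ i _ Cjf) (@dC _ i _ Cjg)).
by apply: sqnorm_parallelogram; [exact: CkS_partial Cjf|exact: CkS_partial Cjg].
Qed.

Lemma hess_energyZ (c : R) f : Ck 2 f ->
  hess_energy (c \*o f)%R = (c ^+ 2)%:E * hess_energy f.
Proof.
move=> Cf; rewrite /hess_energy ge0_sume_distrr; last first.
  by move=> i _; apply: sume_ge0 => j _; exact: sqnorm_ge0.
apply: eq_bigr => i _; rewrite ge0_sume_distrr; last first.
  by move=> j _; exact: sqnorm_ge0.
apply: eq_bigr => j _; have Cjf := CkS_partial j Cf.
rewrite (partialZ c (@dC _ j _ Cf)) (partialZ c (@dC _ i _ Cjf)).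
by apply: sqnormZ; exact: CkS_partial Cjf.
Qed.

Let parallelogram_lty (a b c d : \bar R) : 0 <= a -> 0 <= b ->
  a + b = 2%:E * (c + d) -> c < +oo -> d < +oo -> a < +oo /\ b < +oo.
Proof.
move=> a0 b0 ab coo doo.
have aboo : a + b < +oo.
  by rewrite ab; apply: lte_mul_pinfty => //; exact: lte_add_pinfty.
by split; apply: le_lt_trans aboo; [exact: leeDl|exact: leeDr].
Qed.

(** The defect at [f \+ g] and the defect at [f \- g] are nonnegative and, by the parallelogram law,
    add up to 0. *)
Lemma saturatesD f g : saturates f -> saturates g -> saturates (f \+ g)%R.
Proof.
move=> [Cf foo Hfoo Ef] [Cg goo Hgoo Eg].
have cf := Ck_continuous Cf; have cg := Ck_continuous Cg.
have [C1f C1g] := (CkW Cf, CkW Cg).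
have Cp := CkD Cf Cg; have Cm := CkB Cf Cg.
have [poo moo] := parallelogram_lty (sqnorm_ge0 _) (sqnorm_ge0 _)
  (sqnorm_parallelogram cf cg) foo goo.
have [Hpoo Hmoo] := parallelogram_lty (hess_energy_ge0 _) (hess_energy_ge0 _)
  (hess_energy_parallelogram Cf Cg) Hfoo Hgoo.
split; [exact: Cp|exact: poo|exact: Hpoo|].
have [Gf [Hf [Vf [GfE HfE WfE _ _]]]] := functional_values Cf foo Hfoo.
have [Gg [Hg [Vg [GgE HgE WgE _ _]]]] := functional_values Cg goo Hgoo.
have [Gp [Hp [Vp [GpE HpE WpE _ _]]]] := functional_values Cp poo Hpoo.
have [Gm [Hm [Vm [GmE HmE WmE _ _]]]] := functional_values Cm moo Hmoo.
have := grad_energy_parallelogram C1f C1g.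
have := hess_energy_parallelogram Cf Cg.
have := sqincr_parallelogram cf cg.
have := second_order_poincare_gauss Cp.
have := second_order_poincare_gauss Cm.
move: Ef Eg.
rewrite GfE HfE WfE GgE HgE WgE GpE HpE WpE GmE HmE WmE -!EFinM -!EFinD
  !lee_fin.
move=> [Ef] [Eg] pm pp [W] [H] [G]; congr EFin; lra.
Qed.

Lemma saturatesZ (c : R) f : saturates f -> saturates (c \*o f)%R.
Proof.
move=> [Cf foo Hfoo Ef]; have cf := Ck_continuous Cf; have C1f := CkW Cf.
have c20 : 0 <= (c ^+ 2)%:E by rewrite lee_fin sqr_ge0.
split.
- exact: CkZ.
- by rewrite sqnormZ// lte_mul_pinfty.
- by rewrite hess_energyZ// lte_mul_pinfty.
- rewrite (grad_energyZ c C1f) (hess_energyZ c Cf) (sqincrZ c cf) [LHS]muleCA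
    Ef.
  by rewrite (ge0_muleDr _ (sqincr_ge0 _ _) (hess_energy_ge0 _)).
Qed.

(* The reverse inequality is [second_order_poincare_gauss]. *)
Lemma saturates_bound f (G H V : R) : Ck 2 f -> sqnorm f <= V%:E ->
  grad_energy f = G%:E -> hess_energy f = H%:E -> (2 * G = 2 * V + H)%R ->
  saturates f.
Proof.
move=> Cf fV GE HE GVH.
have foo : sqnorm f < +oo by apply: le_lt_trans fV _; exact: ltry.
have Hoo : hess_energy f < +oo by rewrite HE ltry.
split; [exact: Cf|exact: foo|exact: Hoo|].
apply/eqP; rewrite eq_le second_order_poincare_gauss//=.
(* The variance [s - m ^+ 2] is at most [s], hence at most [V], so the mean [m] is never
   computed. *)
have [m [s [mE sE ->]]] := sqincr_variance (mC (Ck_continuous Cf)) foo.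
rewrite GE HE -EFinM -EFinD lee_fin.
move: fV; rewrite /sqnorm /sqint sE lee_fin => sV.
by have := sqr_ge0 m; lra.
Qed.

End saturation.

(** * Gaussian moments up to order four *)

Section moments.
Context {R : realType}.
Notation mu := (@lebesgue_measure R).
Notation phi := (@normal_pdf R 0 1).
Notation gam := (@normal_prob R 0 1).
Local Open Scope ereal_scope.

Lemma integral_rtail4 : \int[gam]_x (rtail 4 0 x)%:E =
  (3 * gauss_tail (0 : R))%:E.
Proof.
rewrite integral_rtail.
(* Chosen so that [p' x - x * p x] equals x^4 - 3, whence the constant - 3; and x^3 + 3 * x <= 4 *
   x^3 for x >= 1 gives the bound 4. *)
pose p x : R := (- x ^+ 3 - 3 * x)%R; pose p' x : R := (- 3 * x ^+ 2 - 3)%R.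
have dp (x : R) : is_derive x (1 : R)%R p (p' x).
  by apply: is_derive_eq; rewrite /p' /GRing.scale/=; ring.
transitivity (\int[mu]_(x in `[0%R, +oo[) ((p' x - x * p x - - 3) * phi x)%:E).
  by apply: eq_integral => x _; congr (EFin (_ * _)%R); rewrite /p /p'; ring.
rewrite (@integral_itvy_normal _ p p' (- 3)%R 4%R 0%R).
- by congr EFin; rewrite /p; ring.
- move=> x; apply: cvgB; last exact: cvg_cst.
  by apply: cvgM; [exact: cvg_cst|exact: exprn_continuous].
- move=> x x1; have x0 : (0 <= x)%R by exact: le_trans ler01 x1.
  have x3 : (x <= x ^+ 3)%R by rewrite -[leLHS]expr1; apply: ler_weXn2l.
  have x30 : (0 <= x ^+ 3)%R by rewrite exprn_ge0.
  by rewrite ler_norml; apply/andP; split; rewrite /p; lra.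
- move=> x x0; rewrite (_ : (_ - _ - _)%R = x ^+ 4)%R ?exprn_ge0//.
  by rewrite /p /p'; ring.
Qed.

Let integral_tails k : \int[gam]_x (rtail k.+1 0 x + ltail k.+1 0 x)%:E =
  \int[gam]_x (rtail k.+1 (0 : R) x)%:E + \int[gam]_x (rtail k.+1 (0 : R) x)%:E.
Proof.
have mr (t : R) : measurable_fun [set: R] (EFin \o rtail k.+1 t).
  apply/measurable_EFinP.
  exact: (measurableT_comp (measurable_rtail k.+1) (measurable_pair1 t)).
have ml (t : R) : measurable_fun [set: R] (EFin \o ltail k.+1 t).
  apply/measurable_EFinP.
  exact: (measurableT_comp (measurable_ltail k.+1) (measurable_pair1 t)).
under eq_integral do rewrite EFinD.
rewrite (ge0_integralD gam measurableT _ (mr 0%R) _ (ml 0%R)); first last.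
- by move=> x _; rewrite lee_fin ltail_ge0.
- by move=> x _; rewrite lee_fin rtail_ge0.
by rewrite integral_ltail oppr0.
Qed.

Let gauss_tail0 : (gauss_tail (0 : R) = 2^-1)%R.
Proof. by have := gauss_tailN (0 : R); rewrite oppr0 => ?; lra. Qed.

Lemma normal_moment2 : \int[gam]_x (x ^+ 2)%:E = 1.
Proof.
transitivity (\int[gam]_x (rtail 2 0 x + ltail 2 0 x)%:E).
  apply: eq_integral => x _; rewrite /rtail /ltail subr0 sub0r sqrrN.
  by case: ltgtP => [_|_|<-]; rewrite ?addr0 ?add0r ?expr0n/= ?addr0.
rewrite integral_tails integral_rtail2 gauss_tail0 -EFinD; congr EFin.
by rewrite expr0n/=; field.
Qed.

Lemma normal_moment4 : \int[gam]_x (x ^+ 4)%:E = 3%:E.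
Proof.
transitivity (\int[gam]_x (rtail 4 0 x + ltail 4 0 x)%:E).
  apply: eq_integral => x _; rewrite /rtail /ltail subr0 sub0r.
  rewrite (_ : (- x) ^+ 4 = x ^+ 4)%R; last by ring.
  by case: ltgtP => [_|_|<-]; rewrite ?addr0 ?add0r ?expr0n/= ?addr0.
rewrite integral_tails integral_rtail4 gauss_tail0 -EFinD; congr EFin.
by field.
Qed.

Lemma normal_hermite2 : \int[gam]_x ((x ^+ 2 - 1) ^+ 2)%:E = 2%:E.
Proof.
have mX k : measurable_fun [set: R] (fun x : R => (x ^+ k)%:E).
  by apply/measurable_EFinP; exact: exprn_measurable.
have mH : measurable_fun [set: R] (fun x : R => ((x ^+ 2 - 1) ^+ 2)%:E).
  apply/measurable_EFinP; apply: measurable_funX; apply: measurable_funB => //.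
have H0 (x : R) : 0 <= ((x ^+ 2 - 1) ^+ 2)%:E by rewrite lee_fin sqr_ge0.
have X20 (x : R) : 0 <= (x ^+ 2)%:E by rewrite lee_fin sqr_ge0.
(* The expansion is arranged as (x^2 - 1)^2 + 2 * x^2 = 1 + x^4 so that every integrand is
   nonnegative; the value is 1 + 3 - 2. *)
have : \int[gam]_x (((x ^+ 2 - 1) ^+ 2)%:E + ((x ^+ 2)%:E + (x ^+ 2)%:E)) =
    \int[gam]_x (1%:E + (x ^+ 4)%:E).
  by apply: eq_integral => x _; rewrite -!EFinD; congr EFin; ring.
have X40 (x : R) : 0 <= (x ^+ 4)%:E by rewrite lee_fin exprn_even_ge0.
have c0 (x : R) : [set: R] x -> 0 <= cst 1%:E x :> \bar R by rewrite lee_fin.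
rewrite (ge0_integralD gam measurableT (fun x _ => H0 x) mH
  (fun x _ => adde_ge0 (X20 x) (X20 x)) (emeasurable_funD (mX 2%N) (mX 2%N))).
rewrite (ge0_integralD gam measurableT (fun x _ => X20 x) (mX 2%N)
  (fun x _ => X20 x) (mX 2%N)).
rewrite (ge0_integralD gam measurableT c0 (measurable_cst _) (fun x _ => X40 x)
  (mX 4%N)).
rewrite normal_moment2.
rewrite normal_moment4 prob_integral_cst -!EFinD.
case: (\int[gam]_x _) => [r|//|//]; rewrite -EFinD => -[rE].
by congr EFin; lra.
Qed.

Lemma integral_gauss_prod n (g : 'I_n -> R -> R) (c : 'I_n -> R) :
  (forall i, measurable_fun [set: R] (g i)) -> (forall i x, 0 <= g i x)%R ->
  (forall i, \int[gam]_x (g i x)%:E = (c i)%:E) ->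
  \int[gauss n]_x (\prod_i g i (x ord0 i))%:E = (\prod_i c i)%:E.
Proof.
have mp k (h : 'I_k -> R -> R) : (forall i, measurable_fun [set: R] (h i)) ->
    measurable_fun [set: 'rV[R]_k] (fun x => (\prod_i h i (x ord0 i))%:E).
  move=> mh; apply/measurable_EFinP; apply: measurable_prod => i _.
  exact: (measurableT_comp (mh i) (measurable_rV_coor i)).
elim: n g c => [|n IH] g c mg g0 gc.
  under eq_integral do rewrite big_ord0.
  by rewrite big_ord0 prob_integral_cst.
rewrite integral_gauss_cons; last 2 first.
- exact: mp.
- by move=> x; rewrite lee_fin prodr_ge0.
transitivity (\int[gam]_a ((g ord0 a)%:E * (\prod_(i < n) c (lift ord0 i))%:E)).
  apply: eq_integral => a _.
  rewrite -(IH (fun i => g (lift ord0 i)))// -ge0_integralZl//.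
  - apply: eq_integral => y _; rewrite big_ord_recl EFinM /rV_cons.
    rewrite !mxE unlift_none/=; congr (_ * _); congr EFin.
    by apply: eq_bigr => i _; rewrite !mxE liftK.
  - exact: (mp n (fun i => g (lift ord0 i))).
  - by move=> y _; rewrite lee_fin prodr_ge0.
  - by rewrite lee_fin.
rewrite ge0_integralZr//.
- by rewrite gc -EFinM big_ord_recl.
- by apply/measurable_EFinP; exact: mg.
- by move=> a _; rewrite lee_fin.
- rewrite lee_fin prodr_ge0// => i _; rewrite -lee_fin -gc.
  by apply: integral_ge0 => a _; rewrite lee_fin.
Qed.

End moments.

(** * Hermite polynomials of degree at most two, and their span *)

Section quadratic.
Context {R : realType} (n : nat).
Implicit Types f g : 'rV[R]_n -> R.
Notation coor := (@rV_coor R n).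

Lemma partial_cst k (c : R) : partial k (cst c : 'rV[R]_n -> R) = cst 0.
Proof. by apply/funext => x; exact: derive_cst. Qed.

Lemma Ck_cst k (c : R) : Ck k (cst c : 'rV[R]_n -> R).
Proof.
elim: k c => [|k IH] c; first exact: cst_continuous.
split; first exact: cst_continuous.
by move=> i; split; [move=> x; exact: derivable_cst|rewrite partial_cst;
  exact: IH].
Qed.

Lemma is_derive_coor i (x v : 'rV[R]_n) : is_derive x v (coor i) (v ord0 i).
Proof.
have @f : {linear 'rV[R]_n -> R}.
  by exists (fun N : 'rV[R]_n => N ord0 i); do 2![eexists]; do ?[constructor];
     rewrite ?mxE// => ? *; rewrite ?mxE//; move=> ?; rewrite !mxE.
have cf : continuous f by exact: coord_continuous.
have df : differentiable f x := linear_differentiable x cf.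
split; first exact: (diff_derivable df).
by rewrite (deriveE v df) (diff_lin x cf).
Qed.

Lemma partial_coor k i : partial k (coor i) = cst (k == i)%:R.
Proof.
apply/funext => x; have d := is_derive_coor i x (delta_mx ord0 k).
by rewrite /partial derive_val mxE eqxx/= eq_sym.
Qed.

Lemma Ck_coor k i : Ck k (coor i).
Proof.
have cc : continuous (coor i) by exact: coord_continuous.
case: k => [//|k]; split => // j; split.
  by move=> x; case: (is_derive_coor i x (delta_mx ord0 j)).
by rewrite partial_coor; exact: Ck_cst.
Qed.

Lemma partialM k f g : (forall x, derivable f x (delta_mx ord0 k)) ->
  (forall x, derivable g x (delta_mx ord0 k)) ->
  partial k (f \* g) = (f \* partial k g) \+ (g \* partial k f).
Proof. by move=> df dg; apply/funext => x; exact: deriveM. Qed.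

Lemma partial_coorM k i j : partial k (coor i \* coor j) =
  fun x => (k == j)%:R * coor i x + (k == i)%:R * coor j x.
Proof.
rewrite partialM; last 2 first.
- by move=> x; exact: CkS_derivable (Ck_coor 1 i) x.
- by move=> x; exact: CkS_derivable (Ck_coor 1 j) x.
by rewrite !partial_coor; apply/funext => x /=; rewrite !(mulrC (coor _ _)).
Qed.

Lemma partial_lin k (a b : R) i j :
  partial k (fun x => a * coor i x + b * coor j x) =
  cst (a * (k == i)%:R + b * (k == j)%:R).
Proof.
have di i' : forall x, derivable (coor i') x (delta_mx ord0 k).
  by move=> x; exact: CkS_derivable (Ck_coor 1 i') x.
rewrite (_ : (fun x => _) = (a \*o coor i) \+ (b \*o coor j))//.
rewrite partialD; last 2 first.
- by move=> x; apply: derivableZ.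
- by move=> x; apply: derivableZ.
rewrite !partialZ// !partial_coor; exact/funext.
Qed.

Lemma Ck_coorM i j : Ck 2 (coor i \* coor j).
Proof.
have cc k : continuous (coor k) by exact: coord_continuous.
split; first by move=> x; exact: (cvgM (cc i x) (cc j x)).
move=> k; split.
  move=> x; apply: derivableM.
  - exact: CkS_derivable (Ck_coor 1 i) x.
  - exact: CkS_derivable (Ck_coor 1 j) x.
rewrite partial_coorM; exact: (CkD (CkZ _ (Ck_coor 1 i)) (CkZ _ (Ck_coor 1 j))).
Qed.

Lemma partialB_cst k f (c : R) : (forall x, derivable f x (delta_mx ord0 k)) ->
  partial k (f \- cst c) = partial k f.
Proof.
move=> df.
have dc x : derivable (cst c : 'rV[R]_n -> R) x (delta_mx ord0 k)
  by exact: derivable_cst.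
by rewrite (partialB df dc) partial_cst; apply/funext => x /=; rewrite subr0.
Qed.

Lemma sqnorm_cst (c : R) : sqnorm (cst c : 'rV[R]_n -> R) = (c ^+ 2)%:E.
Proof. exact: (prob_integral_cst (gauss n) (c ^+ 2)%:E). Qed.

Let sum_delta (j : 'I_n) : \sum_k (k == j)%:R = 1 :> R.
Proof. by rewrite (bigD1 j)//= eqxx big1 ?addr0// => k /negbTE ->. Qed.

Let sum2_delta (i j : 'I_n) : \sum_l \sum_k (k == j)%:R * (l == i)%:R = 1 :> R.
Proof.
under eq_bigr do rewrite -mulr_suml sum_delta mul1r.
exact: sum_delta.
Qed.

Lemma hess_coorM l k i j : partial l (partial k (coor i \* coor j)) =
  cst ((k == j)%:R * (l == i)%:R + (k == i)%:R * (l == j)%:R).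
Proof. by rewrite partial_coorM partial_lin. Qed.

Lemma hess_energy_coorM i j :
  hess_energy (coor i \* coor j) = (2 + 2 * (i == j)%:R)%:E.
Proof.
rewrite /hess_energy.
under eq_bigr => l _.
  under eq_bigr => k _ do rewrite hess_coorM sqnorm_cst.
  rewrite sumEFin; over.
rewrite sumEFin; congr EFin.
(* The square of a sum of two idempotent Kronecker products; the cross term survives only for i =
   j. *)
transitivity (\sum_l \sum_k ((k == j)%:R * (l == i)%:R +
  (k == i)%:R * (l == j)%:R +
  2 * (i == j)%:R * ((k == i)%:R * (l == i)%:R)) : R).
  apply: eq_bigr => l _; apply: eq_bigr => k _.
  have [->|ij] := eqVneq i j.
    by case: (k == j); case: (l == j); rewrite /=; ring.
  have [->|kj] := eqVneq k j; last by case: (k == i); case: (l == j);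
    rewrite /=; ring.
  by rewrite [j == i]eq_sym (negbTE ij); case: (l == i); rewrite /=; ring.
under eq_bigr do rewrite big_split/= big_split/= -mulr_sumr.
rewrite big_split/= big_split/= -mulr_sumr !sum2_delta; ring.
Qed.

Notation gam := (@normal_prob R 0 1).

Lemma integral_gauss_coor (g : R -> R) i (c : R) :
  measurable_fun [set: R] g -> (forall x, 0 <= g x) ->
  (\int[gam]_x (g x)%:E = c%:E)%E ->
  (\int[gauss n]_x (g (x ord0 i))%:E = c%:E)%E.
Proof.
move=> mg g0 gc; pose G (k : 'I_n) := if k == i then g else cst 1.
have := @integral_gauss_prod R n G (fun k => if k == i then c else 1).
rewrite -big_mkcond big_pred1_eq => <-.
- apply: eq_integral => x _; congr EFin.
  transitivity (\prod_k if k == i then g (x ord0 k) else 1).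
    by rewrite -big_mkcond big_pred1_eq.
  by apply: eq_bigr => k _; rewrite /G; case: ifP.
- by move=> k; rewrite /G; case: ifP.
- by move=> k x; rewrite /G; case: ifP.
- by move=> k; rewrite /G; case: ifP => // _;
    exact: (prob_integral_cst gam 1%:E).
Qed.

Lemma sqnorm_coor i : sqnorm (coor i) = 1%E.
Proof.
apply: (@integral_gauss_coor (fun x => x ^+ 2)) => //.
- by move=> x; exact: sqr_ge0.
- exact: normal_moment2.
Qed.

Lemma sqnorm_coorM i j : i != j -> sqnorm (coor i \* coor j) = 1%E.
Proof.
move=> ij.
pose G (k : 'I_n) (x : R) := (if k == i then x ^+ 2 else 1) *
  (if k == j then x ^+ 2 else 1).
have := @integral_gauss_prod R n G (fun=> 1).
rewrite big1// => <-.
- apply: eq_integral => x _; congr EFin; rewrite /G big_split/=.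
  rewrite -[X in _ = X * _]big_mkcond -[X in _ = _ * X]big_mkcond/=.
  by rewrite !big_pred1_eq exprMn.
- by move=> k; apply: measurable_funM; [case: (k == i)|case: (k == j)] => //;
    exact: exprn_measurable.
- by move=> k x; rewrite /G mulr_ge0//; case: ifP => // _; exact: sqr_ge0.
- move=> k; rewrite /G; have [->|ki] := eqVneq k i.
    rewrite (negbTE ij); under eq_integral do rewrite mulr1.
    exact: normal_moment2.
  case: (k == j); under eq_integral do rewrite mul1r.
    exact: normal_moment2.
  exact: (prob_integral_cst gam 1%:E).
Qed.

Let continuous_coor i : continuous (coor i). Proof. exact: coord_continuous.
  Qed.

Lemma grad_energy_coorM i j : i != j -> grad_energy (coor i \* coor j) = 2%:E.
Proof.
move=> ij; rewrite /grad_energy.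
transitivity (\sum_k ((k == i)%:R + (k == j)%:R : R)%:E)%E.
  apply: eq_bigr => k _; rewrite partial_coorM.
  have [->|kj] := eqVneq k j.
    rewrite [j == i]eq_sym (negbTE ij) add0r -[RHS](sqnorm_coor i).
    by congr sqnorm; apply/funext => x; rewrite mul1r mul0r addr0.
  have [_|_] := eqVneq k i.
    rewrite addr0 -[RHS](sqnorm_coor j).
    by congr sqnorm; apply/funext => x; rewrite mul1r mul0r add0r.
  rewrite addr0 -[RHS](_ : sqnorm (cst 0 : 'rV[R]_n -> R) = _).
    by congr sqnorm; apply/funext => x; rewrite !mul0r addr0.
  by rewrite sqnorm_cst expr0n.
by rewrite sumEFin big_split/= !sum_delta.
Qed.

Lemma saturates_cst (c : R) : saturates (cst c : 'rV[R]_n -> R).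
Proof.
have g0 : grad_energy (cst c : 'rV[R]_n -> R) = 0%E.
  by apply: big1 => i _; rewrite partial_cst sqnorm_cst expr0n.
have h0 : hess_energy (cst c : 'rV[R]_n -> R) = 0%E.
  by apply: big1 => i _; apply: big1 => j _;
    rewrite !partial_cst sqnorm_cst expr0n.
split.
- exact: Ck_cst.
- by rewrite sqnorm_cst ltry.
- by rewrite h0 ltry.
- rewrite g0 h0 mule0 adde0; apply/esym.
  apply: integral0_eq => x _; apply: integral0_eq => y _.
  by rewrite subrr expr0n.
Qed.

Lemma saturates_coor i : saturates (coor i).
Proof.
apply: (@saturates_bound _ _ _ 1 0 1).
- exact: Ck_coor.
- by rewrite sqnorm_coor.
- rewrite /grad_energy; under eq_bigr do rewrite partial_coor sqnorm_cst.
  rewrite sumEFin; congr EFin; rewrite -[RHS](sum_delta i);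
    apply: eq_bigr => k _.
  by case: (k == i); rewrite ?expr1n ?expr0n.
- rewrite /hess_energy; apply: big1 => k _; apply: big1 => l _.
  by rewrite partial_coor partial_cst sqnorm_cst expr0n.
- by ring.
Qed.

(** The gradient energy 2, the Hessian energy 2 (two entries equal to 1) and the second moment 1
    satisfy 2 * 2 = 2 * 1 + 2. *)
Lemma saturates_coorM_neq i j : i != j -> saturates (coor i \* coor j).
Proof.
move=> ij; apply: (@saturates_bound _ _ _ 2 2 1).
- exact: Ck_coorM.
- by rewrite sqnorm_coorM.
- exact: grad_energy_coorM.
- by rewrite hess_energy_coorM (negbTE ij) mulr0 addr0.
- by ring.
Qed.

(** [saturates_bound] compares with the second moment instead of the variance, so the square has to
    be centered. The values are 4 for both energies and 2 for the second moment. *)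
Lemma saturates_hermite2 i : saturates ((coor i \* coor i) \- cst 1).
Proof.
have d k : forall x, derivable (coor i \* coor i) x (delta_mx ord0 k).
  by move=> x; exact: CkS_derivable (Ck_coorM i i) x.
apply: (@saturates_bound _ _ _ 4 4 2).
- exact: CkB (Ck_coorM i i) (Ck_cst 2 1).
- rewrite /sqnorm /sqint.
  rewrite (@integral_gauss_coor (fun x => (x ^+ 2 - 1) ^+ 2) i 2)//.
  + apply: measurable_funX; apply: measurable_funB => //;
      exact: exprn_measurable.
  + by move=> x; exact: sqr_ge0.
  + exact: normal_hermite2.
- rewrite /grad_energy.
  transitivity (\sum_k (4 * (k == i)%:R : R)%:E)%E.
    apply: eq_bigr => k _; rewrite partialB_cst// partial_coorM.
    have [_|_] := eqVneq k i.
      rewrite mulr1 -[RHS]mule1 -(sqnorm_coor i).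
      have -> : 4%:E = ((2 : R) ^+ 2)%:E by congr EFin; ring.
      rewrite -sqnormZ//; congr sqnorm; apply/funext => x /=; ring.
    rewrite mulr0 -[RHS](_ : sqnorm (cst 0 : 'rV[R]_n -> R) = _).
      by congr sqnorm; apply/funext => x; rewrite !mul0r addr0.
    by rewrite sqnorm_cst expr0n.
  by rewrite sumEFin -mulr_sumr sum_delta mulr1.
- transitivity (hess_energy (coor i \* coor i)).
    apply: eq_bigr => l _; apply: eq_bigr => k _; by rewrite partialB_cst.
  by rewrite hess_energy_coorM eqxx mulr1; congr EFin; ring.
- by ring.
Qed.

Lemma saturates_coorM i j : saturates (coor i \* coor j).
Proof.
have [<-|/saturates_coorM_neq//] := eqVneq i j.
have := saturatesD (saturates_hermite2 i) (saturates_cst 1).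
by congr saturates; apply/funext => x /=; rewrite subrK.
Qed.

Let mono (e : 'I_n -> nat) (x : 'rV[R]_n) : R := \prod_i x ord0 i ^+ e i.

(** Peels one variable off a nonconstant monomial: the truncated subtraction lowers only the
    exponent at [i], which is positive. Two rounds reduce degree at most 2 to 1, x_i and x_i *
    x_j. *)
Let monoP (e : 'I_n -> nat) k : (\sum_i e i <= k.+1)%N ->
  mono e = cst 1 \/ exists i e',
    mono e = coor i \* mono e' /\ (\sum_i e' i <= k)%N.
Proof.
move=> ek; have [/forallP e0|] := boolP [forall i, e i == 0%N].
  left; apply/funext => x; apply: big1 => i _.
  by rewrite (eqP (e0 i)).
rewrite negb_forall => /existsP[i ei]; right.
exists i, (fun j => e j - (j == i))%N; split.
  apply/funext => x; rewrite /mono/= (bigD1 i)//= [in RHS](bigD1 i)//= eqxx.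
  rewrite mulrA -[X in X * _ ^+ _ * _]/(x ord0 i) -exprS subn1 prednK ?lt0n//.
  by congr (_ * _); apply: eq_bigr => j /negbTE ->; rewrite subn0.
move: ek; rewrite (bigD1 i)//= [in X in _ -> X](bigD1 i)//= eqxx.
under [in X in _ -> X]eq_bigr => j /negbTE -> do rewrite subn0.
by rewrite subn1; case: (e i) ei => [//|m _]; rewrite addSn ltnS.
Qed.

Let saturates_mono (e : 'I_n -> nat) : (\sum_i e i <= 2)%N ->
  saturates (mono e).
Proof.
move=> /monoP[->|[i [e1 [-> /monoP[->|[j [e2 [-> e20]]]]]]]].
- exact: saturates_cst.
- have := saturates_coor i; congr saturates.
  by apply/funext => x /=; rewrite mulr1.
- have := saturates_coorM i j; congr saturates.
  apply/funext => x /=; congr (_ * _).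
  rewrite /mono big1 ?mulr1// => k _.
  move: e20; rewrite leqn0 sum_nat_eq0 => /forallP/(_ k)/eqP ->.
  by rewrite expr0.
Qed.

Lemma saturates_meval (p : mpoly.mpoly n R) : mpoly_deg p = 2%N ->
  saturates (fun x : 'rV[R]_n => mpoly.meval (fun i => x ord0 i) p).
Proof.
rewrite /mpoly_deg => p2.
rewrite (_ : (fun x => _) = fun x =>
  \sum_(m <- mpoly.msupp p) mpoly.mcoeff m p * mono (mpoly.fun_of_multinom m)
    x); last first.
  by apply/funext => x; rewrite mpoly.mevalE.
(* A bound on the degree passes to sublists of the support, as the induction requires. *)
have : (\max_(m <- mpoly.msupp p) mpoly.mdeg m <= 2)%N by rewrite p2.
elim: (mpoly.msupp p : seq _) => [|m s IH].
  move=> _; have := saturates_cst 0; congr saturates.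
  by apply/funext => x; rewrite big_nil.
rewrite big_cons geq_max mpoly.mdegE => /andP[/saturates_mono sm /IH ss].
have := saturatesD (saturatesZ (mpoly.mcoeff m p) sm) ss; congr saturates.
by apply/funext => x; rewrite big_cons.
Qed.

End quadratic.

Theorem corollary3 (R : realType) (n : nat) :
  (forall phi : 'rV[R]_n -> R,
     Ck 2 phi ->
     phi \in Lfun (gauss n) 2%:E ->
     (fun x => normHS (hess phi x)) \in Lfun (gauss n) 2%:E ->
     (\int[gauss n]_x
        (norm2 (grad phi x) ^+ 2 - normHS (hess phi x) ^+ 2 / 2)%:E
      <= gauss_var phi)%E)
  /\
  (forall p : mpoly.mpoly n R,
     mpoly_deg p = 2%N ->
     let phi := fun x : 'rV[R]_n => mpoly.meval (fun i => x ord0 i) p in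
     (\int[gauss n]_x
        (norm2 (grad phi x) ^+ 2 - normHS (hess phi x) ^+ 2 / 2)%:E
      = gauss_var phi)%E).
Proof.
split; first exact: second_order_inequality.
move=> p p2 phi; have [C foo Hoo E] := saturates_meval p2.
have [G [H [V [GE HE WE -> ->]]]] := functional_values C foo Hoo.
move: E; rewrite GE HE WE -EFinM -EFinD => -[E]; congr EFin.
by rewrite -/(G - H / 2); lra.
Qed.
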